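(* Let $1\le n\le N$. Every valuation $\mu:\mathcal{T}^n\to\mathbb{R}$ has a unique extension to a valuation on $\mathcal{P}^n$; that is, there is exactly one valuation $\bar\mu:\mathcal{P}^n\to\mathbb{R}$ with $\bar\mu(T)=\mu(T)$ for all $T\in\mathcal{T}^n$.
   Context: A polytope is the compact convex hull of finitely many points in $\mathbb{R}^N$. $\mathcal{T}^n$ is the set of simplices of dimension at most $n$ in $\mathbb{R}^N$ (simplices being convex hulls of finitely many affinely independent points), and $\mathcal{P}^n$ is the set of (convex) polytopes of dimension at most $n$ in $\mathbb{R}^N$; both classes include the empty set. A function $\mu:\mathcal{S}\to\mathbb{R}$ defined on a class $\mathcal{S}$ of sets is called a valuation if $\mu(\emptyset)=0$, where $\emptyset$ is the empty set, and $$\mu(S)+\mu(T)=\mu(S\cup T)+\mu(S\cap T)$$ for all $S,T\in\mathcal{S}$ such that $S\cup T\in\mathcal{S}$ and $S\cap T\in\mathcal{S}$ as well. *)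

(* Defs.v *)
From HB Require Import structures.
From mathcomp Require Import all_boot all_order all_algebra.
From mathcomp Require Import boolp classical_sets reals convex.

Set Implicit Arguments.
Unset Strict Implicit.
Unset Printing Implicit Defensive.

Import Order.TTheory GRing.Theory Num.Theory.
Local Open Scope classical_set_scope.
Local Open Scope ring_scope.

Section Polytopes.
Variables (R : realType) (N : nat).
Local Notation V := 'rV[R]_N.

Definition convex_hull (A : set V) : set V := smallest (@convex_set R V) A.

Definition affine_hull (A : set V) : set V :=
  [set x | exists (k : nat) (p : 'I_k -> V) (c : 'I_k -> R),
    [/\ forall i, A (p i), \sum_i c i = 1 & x = \sum_i c i *: p i]].

Definition affinely_independent (k : nat) (p : 'I_k -> V) : Prop :=
  forall c : 'I_k -> R,
    \sum_i c i = 0 -> \sum_i c i *: p i = 0 -> forall i, c i = 0.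

Definition has_dim (A : set V) (d : nat) : Prop :=
  exists (x : V) (W : {vspace V}),
    \dim W = d /\ affine_hull A = [set x + w | w in [set` W]].

(* has_dim never holds of set0, whose dimension is negative by convention. *)
Definition dim_le (A : set V) (n : nat) : Prop :=
  A = set0 \/ exists2 d, (d <= n)%N & has_dim A d.

(* k = 0 is allowed, both here and in polytopes: it yields the empty set. *)
Definition simplices (n : nat) : set (set V) :=
  [set S | (exists (k : nat) (p : 'I_k -> V),
              affinely_independent p /\ S = convex_hull (range p))
           /\ dim_le S n].

Definition polytopes (n : nat) : set (set V) :=
  [set P | (exists (k : nat) (p : 'I_k -> V), P = convex_hull (range p))
           /\ dim_le P n].

(* A class C of sets is coerced to the type of its members, so mu is defined
   on C only. *)
Definition valuation (C : set (set V)) (mu : C -> R) : Prop :=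
  (forall h0 : set0 \in C, mu (SigSub h0) = 0) /\
  (forall (S T : C) (hU : val S `|` val T \in C) (hI : val S `&` val T \in C),
     mu S + mu T = mu (SigSub hU) + mu (SigSub hI)).

Lemma convex_hull0 : convex_hull set0 = set0.
Proof.
apply/seteqP; split => // x; apply; split => //.
Qed.

Lemma simplices0 n : simplices n set0.
Proof.
split; last by left.
have p : 'I_0 -> V by case.
exists 0%N, p; split; first by move=> c _ _ [].
suff -> : range p = set0 by rewrite convex_hull0.
by apply/seteqP; split => // x [[]].
Qed.

Lemma simplices_polytopes n : simplices n `<=` polytopes n.
Proof. by move=> S [[k [p [_ ->]]] dS]; split => //; exists k, p. Qed.

Definition polytope_of_simplex n (T : simplices n) : polytopes n :=
  SigSub (mem_set (simplices_polytopes (set_mem (valP T)))).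

End Polytopes.

Arguments simplices R N n : clear implicits.
Arguments polytopes R N n : clear implicits.

(* Main.v *)
(* Two facts yield the theorem.

   (1) A property of polytopes that holds for simplices and passes from A, B and
   their intersection to their union holds for all polytopes.  Cover P by
   simplices spanned by its vertices (Caratheodory) and cut P by all hyperplanes
   bounding them; each piece is the intersection of a simplex with halfspaces,
   and such an intersection is reached from simplices by cutting edges at
   points.  Hence uniqueness, and the indicator function of a polytope is an
   integral combination of indicator functions of simplices.

   (2) A valuation mu on simplices respects every linear relation between their
   indicator functions, so that nu P = sum_i c_i mu S_i is well defined whenever
   1_P = sum_i c_i 1_{S_i}.  Working modulo the values of simplices of smaller
   dimension, mu is simple: cutting an edge splits the value without correction
   term.  Fixing the apex 0, mu S is then a signed sum of the values of the cones
   over the facets of S.  Collect the facets by the hyperplane H they span: for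
   H not through 0, F |-> mu (cone over F) is a simple valuation in H, and the
   jump across H of a relation between the simplices is a relation between
   their facets in H, so one concludes by induction on the dimension. *)

From HB Require Import structures.
Require Import Defs.
From mathcomp Require Import all_boot all_order all_algebra.
From mathcomp Require Import boolp classical_sets functions reals convex.
From mathcomp Require Import ring lra interval_inference.

Set Implicit Arguments.
Unset Strict Implicit.
Unset Printing Implicit Defensive.

Import Order.TTheory GRing.Theory Num.Theory.
Local Open Scope classical_set_scope.
Local Open Scope ring_scope.
Local Open Scope convex_scope.

(** * Convex hulls of finite families *)

Definition upd (T : Type) k (s : 'I_k -> T) (i : 'I_k) (z : T) : 'I_k -> T :=
  fun j => if j == i then z else s j.

Lemma upd_same (T : Type) k (s : 'I_k -> T) i z : upd s i z i = z.
Proof. by rewrite /upd eqxx. Qed.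

Lemma upd_other (T : Type) k (s : 'I_k -> T) i j z : j != i -> upd s i z j = s j.
Proof. by rewrite /upd => /negPf->. Qed.

Lemma upd_id (T : Type) k (s : 'I_k -> T) i : upd s i (s i) = s.
Proof. by apply/funext => j; rewrite /upd; case: eqP => [->|]. Qed.

Lemma upd_upd (T : Type) k (s : 'I_k -> T) i x y : upd (upd s i x) i y = upd s i y.
Proof. by apply/funext => j; rewrite /upd; case: eqP. Qed.

Lemma upd_comm (T : Type) k (s : 'I_k -> T) i j x y : i != j ->
  upd (upd s i x) j y = upd (upd s j y) i x.
Proof.
move=> ij; apply/funext => l; rewrite /upd; case: (eqVneq l j) => // ->.
by rewrite eq_sym (negPf ij).
Qed.

Section Geometry.
Variables (R : realType) (N : nat).
Local Notation V := 'rV[R]_N.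
Implicit Types (x y z : V) (w : 'cV[R]_(1 + N)).

(* Homogeneous coordinates turn affine combinations into linear ones. *)
Definition homog x : 'rV[R]_(1 + N) := row_mx (const_mx 1) x.

(* A column w is read as the affine functional x |-> (1, x) w. *)
Definition ev w x : R := (homog x *m w) 0 0.

Definition homogm k (s : 'I_k -> V) : 'M[R]_(k, 1 + N) := \matrix_i homog (s i).

(** The condition that the weights sum to 1 is the first homogeneous coordinate of the equation. *)
Definition fhull k (s : 'I_k -> V) : set V :=
  [set x | exists l : 'I_k -> R,
     (forall i, 0 <= l i) /\ homog x = \sum_i l i *: homog (s i)].

Lemma homog_inj : injective homog.
Proof. by move=> x y /eq_row_mx[]. Qed.

Lemma homog_sum k (l : 'I_k -> R) (s : 'I_k -> V) :
  \sum_i l i *: homog (s i) = row_mx (const_mx (\sum_i l i)) (\sum_i l i *: s i).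
Proof.
apply/rowP => j; rewrite summxE; case: (split_ordP j) => j' ->.
  rewrite row_mxEl mxE; apply: eq_bigr => i _.
  by rewrite mxE row_mxEl mxE mulr1.
rewrite row_mxEr summxE; apply: eq_bigr => i _.
by rewrite mxE row_mxEr mxE.
Qed.

Lemma homog_combP k (l : 'I_k -> R) (s : 'I_k -> V) x :
  homog x = \sum_i l i *: homog (s i) <->
  \sum_i l i = 1 /\ x = \sum_i l i *: s i.
Proof.
rewrite homog_sum; split=> [/eq_row_mx[/matrixP /(_ 0 0)]|[-> <-]//].
by rewrite !mxE.
Qed.

Lemma homog_comb_sum1 k (l : 'I_k -> R) (s : 'I_k -> V) x :
  homog x = \sum_i l i *: homog (s i) -> \sum_i l i = 1.
Proof. by case/homog_combP. Qed.

Lemma homog_comb2 (a b : R) x y : a + b = 1 ->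
  homog (a *: x + b *: y) = a *: homog x + b *: homog y.
Proof.
move=> ab; rewrite /homog !scale_row_mx add_row_mx; congr row_mx.
by apply/rowP => i; rewrite !mxE !mulr1 ab.
Qed.

Lemma aindP k (s : 'I_k -> V) :
  affinely_independent s <->
  forall l : 'I_k -> R, \sum_i l i *: homog (s i) = 0 -> forall i, l i = 0.
Proof.
split=> + l => /(_ l); rewrite homog_sum => H.
  rewrite -row_mx0 => /eq_row_mx[/matrixP /(_ 0 0)]; rewrite !mxE; exact: H.
by move=> s0 s1; apply: H; rewrite s0 s1 -row_mx0; congr row_mx.
Qed.

Lemma homogm_comb k (s : 'I_k -> V) (l : 'rV[R]_k) :
  l *m homogm s = \sum_i l 0 i *: homog (s i).
Proof. by rewrite mulmx_sum_row; apply: eq_bigr => i _; rewrite rowK. Qed.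

Lemma aind_row_free k (s : 'I_k -> V) : affinely_independent s <-> row_free (homogm s).
Proof.
split=> [/aindP H|H].
  rewrite -kermx_eq0; apply/eqP/row_matrixP => i; rewrite row0.
  have := H (fun j => kermx (homogm s) i j) => {}H.
  apply/rowP => j; rewrite [LHS]mxE [RHS]mxE; apply: H.
  transitivity (row i (kermx (homogm s)) *m homogm s); last first.
    by rewrite -row_mul mulmx_ker row0.
  by rewrite homogm_comb; apply: eq_bigr => j' _; rewrite [row _ _ _ _]mxE.
apply/aindP => l l0 i.
have : \row_j l j *m homogm s = 0 *m homogm s.
  by rewrite mul0mx homogm_comb -[RHS]l0; apply: eq_bigr => j _; rewrite mxE.
by move/(row_free_inj H)/rowP => /(_ i); rewrite !mxE.
Qed.

Lemma aind_uniq k (s : 'I_k -> V) (l m : 'I_k -> R) : affinely_independent s ->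
  \sum_i l i *: homog (s i) = \sum_i m i *: homog (s i) -> l =1 m.
Proof.
move=> /aindP H E i; apply/eqP; rewrite -subr_eq0; apply/eqP.
apply: (H (fun i => l i - m i)).
under eq_bigr do rewrite scalerBl.
by rewrite sumrB E subrr.
Qed.

Lemma homog_comb_homog k (s : 'I_k -> V) i :
  homog (s i) = \sum_j (j == i)%:R *: homog (s j).
Proof.
rewrite (bigD1 i) //= eqxx scale1r big1 ?addr0 // => j /negPf->.
by rewrite scale0r.
Qed.

(** Change of coordinates from the new family back to [s], by substituting the combination for z;
    the Kronecker delta removes the old share of [s i]. *)
Lemma upd_comb k (s : 'I_k -> V) i z (a l : 'I_k -> R) :
  homog z = \sum_j a j *: homog (s j) ->
  \sum_j l j *: homog (upd s i z j) =
  \sum_j (l j + l i * (a j - (j == i)%:R)) *: homog (s j).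
Proof.
move=> hz.
under [RHS]eq_bigr do rewrite scalerDl mulrBr scalerBl -!scalerA.
rewrite big_split sumrB /= -!scaler_sumr -hz -homog_comb_homog.
rewrite (bigD1 i) //= [in RHS](bigD1 i) //= upd_same [RHS]addrAC.
rewrite [l i *: homog (s i) + _]addrC subrK; congr +%R; apply: eq_bigr => j ji.
by rewrite upd_other.
Qed.

(** Steinitz exchange: a relation for the new family, rewritten in [s], has coefficient [l i * a i]
    at i, so [l i] vanishes and a relation for [s] remains. *)
Lemma aind_upd k (s : 'I_k -> V) i z (a : 'I_k -> R) :
  affinely_independent s -> homog z = \sum_j a j *: homog (s j) -> a i != 0 ->
  affinely_independent (upd s i z).
Proof.
move=> /aindP H hz ai; apply/aindP => l; rewrite (upd_comb _ _ hz) => /H {}H.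
have li : l i = 0.
  have := H i; rewrite eqxx mulrBr mulr1 addrC subrK => /eqP.
  by rewrite mulf_eq0 (negPf ai) orbF => /eqP.
by move=> j; have := H j; rewrite li mul0r addr0.
Qed.

Lemma aind_comp k k' (s : 'I_k -> V) (f : 'I_k' -> 'I_k) : injective f ->
  affinely_independent s -> affinely_independent (s \o f).
Proof.
move=> finj /aindP H; apply/aindP => l l0 i.
have := H (fun j => \sum_(i | f i == j) l i) => /(_ _ (f i)) <-.
  by rewrite (big_pred1 i) // => i'; rewrite /= (inj_eq finj).
rewrite -[RHS]l0 (partition_big f predT) //=; apply: eq_bigr => j _.
by rewrite scaler_suml; apply: eq_bigr => i' /eqP <-.
Qed.

Lemma range_comb2 k (s : 'I_k -> V) i j (t : R) (z : V) : z = (1 - t) *: s i + t *: s j ->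
  homog z = \sum_l ((1 - t) * (l == i)%:R + t * (l == j)%:R) *: homog (s l).
Proof.
move=> ->; rewrite homog_comb2 ?subrK // {1}(homog_comb_homog s i) (homog_comb_homog s j).
rewrite !scaler_sumr -big_split; apply: eq_bigr => l _ /=.
by rewrite !scalerA scalerDl.
Qed.

Lemma convex_comb (A : set V) k (l : 'I_k -> R) (s : 'I_k -> V) :
  @convex_set R V A -> (forall i, 0 <= l i) -> \sum_i l i = 1 ->
  (forall i, A (s i)) -> A (\sum_i l i *: s i).
Proof.
move=> cA; elim: k l s => [|k IH] l s l0 l1 As.
  by move: l1; rewrite big_ord0 => /eqP; rewrite eq_sym oner_eq0.
rewrite big_ord_recl; move: l1; rewrite big_ord_recl /=.
set r := \sum_(i < k) _ => l1.
have r0 : 0 <= r by apply: sumr_ge0.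
have [re0|rn0] := eqVneq r 0.
  rewrite big1 ?addr0 => [|i _]; last first.
    move/eqP: re0; rewrite psumr_eq0 // => /allP /(_ i (mem_index_enum _)) /eqP ->.
    by rewrite scale0r.
  by move: l1; rewrite re0 addr0 => ->; rewrite scale1r.
have l01 : 0 <= l ord0 <= 1 by rewrite l0 /= -l1 lerDl.
have := cA (s ord0) (r^-1 *: \sum_(i < k) l (lift ord0 i) *: s (lift ord0 i)).
(* [convex_set] takes its weight in a type of certified elements of [0, 1], so [l ord0] is packed
   with a certificate. *)
have I : Itv.spec (@Itv.num_sem _) (Itv.Real `[0%Z, 1%Z]) (l ord0).
  by apply/andP; split; [rewrite num_real|rewrite /= in_itv /= l01].
move=> /(_ (Itv.mk I)); rewrite !inE => /(_ (As _)).
rewrite [_ <| _ |> _](_ : _ = l ord0 *: s ord0 + (1 - l ord0) *: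
  (r^-1 *: \sum_(i < k) l (lift ord0 i) *: s (lift ord0 i))) //.
have -> : 1 - l ord0 = r by rewrite -l1 addrC addKr.
rewrite scalerA divff // scale1r; apply.
rewrite scaler_sumr.
under eq_bigr do rewrite scalerA.
by apply: IH => [i||//]; rewrite ?mulr_ge0 ?invr_ge0 // -mulr_sumr mulVf.
Qed.

Lemma fhullE k (s : 'I_k -> V) : convex_hull (range s) = fhull s.
Proof.
apply/seteqP; split.
  apply: smallest_sub; last first.
    move=> _ [i _ <-]; exists (fun j => (j == i)%:R); split=> [j|].
      by rewrite ler0n.
    exact: homog_comb_homog.
  move=> x y t; rewrite !inE => -[l [l0 hx]] [m [m0 hy]].
  exists (fun i => t%:num * l i + (1 - t%:num) * m i); split=> [i|].
    by rewrite addr_ge0 // mulr_ge0 // subr_ge0.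
  rewrite [_ <| _ |> _](_ : _ = t%:num *: x + (1 - t%:num) *: y) //.
  rewrite homog_comb2; last by rewrite addrC subrK.
  rewrite hx hy !scaler_sumr -big_split; apply: eq_bigr => i _.
  by rewrite !scalerA scalerDl.
move=> x [l [l0 /homog_combP[l1 ->]]] A [cA sA].
by apply: convex_comb => // i; apply: sA; exists i.
Qed.

Lemma convex_convex_hull (A : set V) : @convex_set R V (convex_hull A).
Proof.
move=> x y t /set_mem Hx /set_mem Hy; apply/mem_set => C [cC AC].
by apply/set_mem/cC; apply/mem_set; [apply: Hx|apply: Hy].
Qed.

Lemma fhull_sub k k' (s : 'I_k -> V) (s' : 'I_k' -> V) :
  range s `<=` fhull s' -> fhull s `<=` fhull s'.
Proof.
move=> H; rewrite -fhullE; apply: smallest_sub => //.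
by rewrite -fhullE; exact: convex_convex_hull.
Qed.

End Geometry.

(** * Cutting an edge *)

Section Edges.
Variables (R : realType) (N : nat).
Local Notation V := 'rV[R]_N.

Lemma mem_fhull k (s : 'I_k -> V) i : fhull s (s i).
Proof. by rewrite -fhullE; apply: sub_gen_smallest; exists i. Qed.

Lemma fhull_range k k' (s : 'I_k -> V) (s' : 'I_k' -> V) :
  range s `<=` range s' -> fhull s `<=` fhull s'.
Proof. by move=> H; apply: fhull_sub => x /H[i _ <-]; exact: mem_fhull. Qed.

Lemma range_upd_lift k (s : 'I_k.+1 -> V) i j z : i != j ->
  range (upd s i z \o lift j) `<=` range (upd s j z).
Proof.
move=> ij _ [l _ <-] /=; case: (eqVneq (lift j l) i) => [->|li].
  by rewrite upd_same; exists j => //; rewrite upd_same.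
rewrite upd_other //; exists (lift j l) => //.
by rewrite upd_other // eq_sym neq_lift.
Qed.

Lemma range_comp_sub (T U : Type) k (s : T -> U) (f : 'I_k -> T) :
  range (s \o f) `<=` range s.
Proof. by move=> _ [i _ <-]; exists (f i). Qed.

Lemma fhull_upd_sub k (s : 'I_k -> V) i (z : V) : fhull s z ->
  fhull (upd s i z) `<=` fhull s.
Proof.
move=> sz; apply: fhull_sub => _ [j _ <-].
by rewrite /upd; case: eqP => // _; exact: mem_fhull.
Qed.

Lemma fhull_edge_pt k (s : 'I_k -> V) i j (t : R) (z : V) : 0 < t < 1 ->
  z = (1 - t) *: s i + t *: s j -> fhull s z.
Proof.
move=> /andP[t0 t1] /range_comb2 hz; eexists; split; last exact: hz.
by move=> l; rewrite addr_ge0 // mulr_ge0 ?subr_ge0 // ltW.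
Qed.

(** The inequality places x on the [s j] side of the cut. The new weights come from solving the
    equation of z for [s i]; the inequality is what keeps the weight of [s j] nonnegative. *)
Lemma fhull_edge_side k (s : 'I_k -> V) i j (t : R) (z x : V) (l : 'I_k -> R) :
  i != j -> 0 < t < 1 -> z = (1 - t) *: s i + t *: s j ->
  (forall m, 0 <= l m) -> homog x = \sum_m l m *: homog (s m) ->
  t * l i <= (1 - t) * l j -> fhull (upd s i z) x.
Proof.
move=> ij /andP[t0 t1] /range_comb2 hz l0 hx lij.
have t1' : 0 < 1 - t by rewrite subr_gt0.
pose m n := if n == i then l i / (1 - t) else
  if n == j then l j - t * l i / (1 - t) else l n.
exists m; split=> [n|].
  rewrite /m; case: eqP => _; first by rewrite divr_ge0 // ltW.
  by case: eqP => // _; rewrite subr_ge0 ler_pdivrMr // [l j * _]mulrC.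
rewrite (upd_comb _ _ hz) hx; apply: eq_bigr => n _; congr (_ *: _).
have te : 1 - t != 0 by rewrite gt_eqF.
rewrite /m eqxx; case: (eqVneq n i) => [->|ni].
  by rewrite (negPf ij) /=; field.
by case: (eqVneq n j) => [->|nj] /=; field.
Qed.

Lemma fhull_edgeU k (s : 'I_k -> V) i j (t : R) (z : V) : i != j -> 0 < t < 1 ->
  z = (1 - t) *: s i + t *: s j ->
  fhull s = fhull (upd s i z) `|` fhull (upd s j z).
Proof.
move=> ij t01 hz; apply/seteqP; split=> [x [l [l0 hx]]|]; last first.
  by rewrite subUset; split; apply: fhull_upd_sub; apply: fhull_edge_pt hz.
have [lij|/ltW lij] := leP (t * l i) ((1 - t) * l j).
  by left; apply: fhull_edge_side hx lij.
(* The other side is the same statement with the edge read backwards, where z has parameter 1 -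
   t. *)
right; apply: (@fhull_edge_side _ _ j i (1 - t) _ _ l) => //.
- by rewrite eq_sym.
- by rewrite subr_gt0 gtrBl andbC.
- by rewrite hz addrC subKr.
- by rewrite subKr.
Qed.

Lemma fhull_edgeI k (s : 'I_k.+1 -> V) i j (t : R) (z : V) :
  affinely_independent s -> i != j -> 0 < t < 1 ->
  z = (1 - t) *: s i + t *: s j ->
  fhull (upd s i z) `&` fhull (upd s j z) = fhull (upd s i z \o lift j).
Proof.
move=> sI ij t01 hz; apply/seteqP; split=> [x|]; last first.
  rewrite subsetI; split; apply: fhull_range; first exact: range_comp_sub.
  exact: range_upd_lift.
have {hz} hz := range_comb2 hz.
case=> [[l [l0 hx]] [m [m0]]]; rewrite hx.
rewrite (upd_comb _ _ hz) (upd_comb _ _ hz) => E.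
have {}E := aind_uniq sI E.
have lj : l j = 0.
  have := E i; have := E j; rewrite !eqxx (negPf ij) [j == i]eq_sym (negPf ij) /=.
  have := l0 j; have := m0 i; case/andP: t01 => t0 t1.
  move: (l i) (l j) (m i) (m j) => a b c d c0 b0 E1 E2.
  (* Eliminating [l i] and [m j] from the coordinates at i and j equates the nonnegative (1 - t) l_j
     with the nonpositive - t m_i. *)
  have : b * (1 - t) = - t * c by nra.
  nra.
exists (l \o lift j); split=> [n|]; first exact: l0.
by rewrite hx (bigD1_ord j) //= lj scale0r add0r.
Qed.

Lemma aind_edge k (s : 'I_k -> V) i j (t : R) (z : V) :
  affinely_independent s -> i != j -> 0 < t < 1 ->
  z = (1 - t) *: s i + t *: s j ->
  affinely_independent (upd s i z) /\ affinely_independent (upd s j z).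
Proof.
move=> sI ij /andP[t0 t1] /range_comb2 hz.
split; apply: (aind_upd sI hz).
  by rewrite eqxx (negPf ij) mulr0 addr0 mulr1 subr_eq0 eq_sym lt_eqF.
by rewrite eqxx [j == i]eq_sym (negPf ij) mulr0 add0r mulr1 gt_eqF.
Qed.

End Edges.

(** * Simple valuations *)

Section Simple.
Variables (R : realType) (N : nat) (G : zmodType).
Local Notation V := 'rV[R]_N.

(* No term for the common face of the two pieces: simple valuations vanish on it. *)
Definition simple_additive k (mu : set V -> G) : Prop :=
  forall (s : 'I_k -> V) i j (t : R) (z : V), affinely_independent s -> i != j ->
    0 < t < 1 -> z = (1 - t) *: s i + t *: s j ->
    mu (range s) = mu (range (upd s i z)) + mu (range (upd s j z)).

Lemma range_upd_swap (T : Type) k (s : 'I_k -> T) i j x y : i != j ->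
  range (upd (upd s i x) j y) = range (upd (upd s i y) j x).
Proof.
have gen x' y' : i != j ->
    range (upd (upd s i x') j y') `<=` range (upd (upd s i y') j x').
  move=> ij _ [l _ <-].
  case: (eqVneq l j) => [->|lj].
    by exists i => //; rewrite upd_same upd_other // upd_same.
  case: (eqVneq l i) => [->|li]; last by exists l => //; rewrite !upd_other.
  by exists j => //; rewrite upd_same upd_other // upd_same.
by move=> ij; apply/seteqP; split; exact: gen.
Qed.

Variables (k : nat) (mu : set V -> G).
Hypothesis muA : simple_additive k mu.

(** Here z may lie on the line outside the edge. Since a + b = 1, one weight is positive, say b. If
    a < 0, then [s j] lies between [s i] and z, and cutting the simplex [upd s j z] at [s j] gives
    [s] and [upd s i z] as its pieces, up to the order of vertices. *)
Lemma signed_cut (s : 'I_k -> V) i j (a b : R) (z : V) :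
  affinely_independent s -> i != j -> a + b = 1 -> a != 0 -> b != 0 ->
  z = a *: s i + b *: s j ->
  mu (range s) = mu (range (upd s i z)) *~ sgz a + mu (range (upd s j z)) *~ sgz b.
Proof.
wlog b0 : i j a b / 0 < b => [wl|] sI ij ab an bn hz.
  have [b0|b0] := ltP 0 b; first exact: wl.
  rewrite addrC; apply: wl => //; rewrite ?[j == i]eq_sym // 1?addrC //; lra.
have hz' : homog z = \sum_l (a * (l == i)%:R + b * (l == j)%:R) *: homog (s l).
  have -> : a = 1 - b by lra.
  by apply: range_comb2; rewrite hz; congr (_ *: _ + _); lra.
have [a0|a0] := ltP 0 a.
  rewrite !gtr0_sgz // !mulr1z; apply: (muA (t := b)) => //.
    by rewrite b0 /= -ab ltrDr.
  by rewrite hz; congr (_ *: _ + _); lra.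
have {an} {}a0 : a < 0 by rewrite lt_neqAle an.
rewrite ltr0_sgz // gtr0_sgz // mulr1z mulrN1z.
have zI : affinely_independent (upd s j z).
  by apply: (aind_upd sI hz'); rewrite eqxx [j == i]eq_sym (negPf ij) mulr0 add0r mulr1.
have b1 : 1 < b by rewrite -ab gtrDr.
have := muA (t := b^-1) (z := s j) zI ij.
rewrite upd_same upd_other // upd_upd upd_id => ->; first last.
- rewrite hz (_ : a = 1 - b); last lra.
  rewrite scalerDr !scalerA mulVf // scale1r addrA -scalerDl.
  rewrite [X in X *: _](_ : _ = 0) ?scale0r ?add0r //; by field.
- by rewrite invr_gt0 b0 invf_lt1.
rewrite addrC -addrA [X in _ = X]addrC.
rewrite upd_comm 1?eq_sym // (_ : range (upd (upd s i (s j)) j z) = range (upd s i z)).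
  by rewrite subrK.
by rewrite range_upd_swap // upd_comm // upd_id.
Qed.

(* If l i + l j <> 0, cut the edge at the point dividing it in the ratio of l i and
   l j: in either piece O has fewer nonzero barycentric coordinates. *)
Lemma cone_formula (s : 'I_k -> V) (l : 'I_k -> R) (O : V) :
  affinely_independent s -> homog O = \sum_i l i *: homog (s i) ->
  mu (range s) = \sum_i mu (range (upd s i O)) *~ sgz (l i).
Proof.
have [m] := ubnP #|[pred i | l i != 0]|.
elim: m s l => // m IH s l lm sI hO.
have l1 := homog_comb_sum1 hO.
have [[i [j [ij li lj lij]]]|none] := pselect
  (exists i j, [/\ i != j, l i != 0, l j != 0 & l i + l j != 0]).
  pose c := l i + l j; pose z := (l i / c) *: s i + (l j / c) *: s j.
  have ab1 : l i / c + l j / c = 1 by rewrite -mulrDl divff.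
  have an : l i / c != 0 by rewrite mulf_neq0 // invr_eq0.
  have bn : l j / c != 0 by rewrite mulf_neq0 // invr_eq0.
  have cut (s' : 'I_k -> V) : affinely_independent s' -> s' i = s i -> s' j = s j ->
      mu (range s') = mu (range (upd s' i z)) *~ sgz (l i / c) +
                      mu (range (upd s' j z)) *~ sgz (l j / c).
    by move=> s'I si sj; apply: signed_cut => //; rewrite si sj.
  have hz : homog z =
      \sum_n (l i / c * (n == i)%:R + l j / c * (n == j)%:R) *: homog (s n).
    have -> : l i / c = 1 - l j / c by lra.
    by apply: range_comb2; rewrite /z; congr (_ *: _ + _); lra.
  (* The induction hypothesis for one piece: with z in place of [s i'], the coordinates of O become
     c at z, 0 at [s j'], and stay the same elsewhere. *)
  have half (i' j' : 'I_k) : i' != j' -> l i' != 0 -> l j' != 0 ->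
      c = l i' + l j' ->
      homog z = \sum_n (l i' / c * (n == i')%:R + l j' / c * (n == j')%:R) *: homog (s n) ->
      mu (range (upd s i' z)) = mu (range (upd s i' O)) *~ sgz c +
        \sum_(n | (n != i') && (n != j')) mu (range (upd (upd s n O) i' z)) *~ sgz (l n).
    move=> ij' li' lj' hc hz'.
    pose l' n := if n == i' then c else if n == j' then 0 else l n.
    rewrite (IH _ l').
    - rewrite (bigD1 i') //= (bigD1 j') 1?eq_sym //= /l' eqxx.
      rewrite [j' == i']eq_sym (negPf ij') eqxx sgz0 mulr0z add0r upd_upd; congr +%R.
      apply: eq_bigr => n /andP[ni nj].
      by rewrite (negPf ni) (negPf nj) upd_comm // eq_sym.
    - move: lm; rewrite !ltnS; apply: leq_trans.
      apply: proper_card; apply/properP; split.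
        apply/fintype.subsetP => n; rewrite !inE /l'.
        by case: (eqVneq n i') => [->//|_]; case: (eqVneq n j') => [->|]; rewrite ?eqxx.
      by exists j'; rewrite !inE // /l' [j' == i']eq_sym (negPf ij') !eqxx.
    - apply: (aind_upd sI hz').
      by rewrite eqxx (negPf ij') mulr0 addr0 mulr1 hc mulf_neq0 ?invr_eq0 -?hc.
    - rewrite (upd_comb _ _ hz') hO; apply: eq_bigr => n _; congr (_ *: _).
      rewrite /l' eqxx; case: (eqVneq n i') => [->|ni].
        by rewrite (negPf ij') /=; field.
      by case: (eqVneq n j') => [->|nj] /=; field.
  have ji : j != i by rewrite eq_sym.
  have cE : c = l j + l i by rewrite /c addrC.
  have hz2 : homog z =
      \sum_n (l j / c * (n == j)%:R + l i / c * (n == i)%:R) *: homog (s n).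
    by rewrite hz; apply: eq_bigr => n _; rewrite addrC.
  rewrite (cut s) // (half i j) // (half j i) //.
  rewrite [RHS](bigD1 i) //= [in RHS](bigD1 j) //=.
  rewrite !mulrzDl -!mulrzA.
  have sg a : a != 0 -> sgz c * sgz (a / c) = sgz a.
    by move=> an'; rewrite -sgzM mulrC divfK.
  rewrite !sg // addrACA [RHS]addrA; congr +%R.
  rewrite [X in _ + X *~ _](eq_bigl (fun n => (n != i) && (n != j))); last first.
    by move=> n; rewrite andbC.
  rewrite !mulrz_suml -big_split; apply: eq_bigr => n /andP[ni nj] /=.
  have [->|ln] := eqVneq (l n) 0; first by rewrite sgz0 !mulr0z !mul0rz addr0.
  (* For n other than i and j the terms of both halves recombine, because z cuts the same edge in
     the simplex with [s n] replaced by O. *)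
  rewrite ![_ *~ sgz (l n) *~ _]mulrzAC -mulrzDl -cut //.
  - by apply: (aind_upd sI hO).
  - by rewrite upd_other // eq_sym.
  - by rewrite upd_other // eq_sym.
have [i li] : exists i, l i != 0.
  apply: contrapT => /forallNP H; move: l1; rewrite big1 => [/eqP|i _].
    by rewrite eq_sym oner_eq0.
  by apply/eqP/negPn/negP; exact: H.
(* Now any two nonzero coordinates are opposite. Three cannot be pairwise opposite, and two opposite
   ones do not sum to 1; so only one is nonzero, and O is a vertex. *)
have {none} none i' j : i' != j -> l i' != 0 -> l j != 0 -> l j = - l i'.
  move=> ij li' lj; apply/eqP; rewrite -addr_eq0 addrC; apply/negPn/negP => lij.
  by apply: none; exists i', j.
have [|li0] := pselect (exists2 j, j != i & l j != 0).
  move=> [j ji lj].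
  have lji : l j = - l i by apply: none; rewrite // eq_sym.
  have l0 n : n != i -> n != j -> l n = 0.
    move=> ni nj; apply/eqP/negPn/negP => ln.
    have : l n = - l i by apply: none; rewrite // eq_sym.
    have : l n = - l j by apply: none; rewrite // eq_sym.
    by rewrite lji; move/eqP: li; lra.
  move: l1; rewrite (bigD1 i) //= (bigD1 j) //= big1 => [|n /andP[]]; last exact: l0.
  by rewrite lji addr0 subrr => /eqP; rewrite eq_sym oner_eq0.
have l0 n : n != i -> l n = 0.
  by move=> ni; apply/eqP/negPn/negP => ln; apply: li0; exists n.
have {}l1 : l i = 1.
  by move: l1; rewrite (bigD1 i) //= big1 ?addr0 // => n; exact: l0.
rewrite (bigD1 i) //= big1 => [|n ni]; last by rewrite l0 // sgz0 mulr0z.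
rewrite l1 sgz1 mulr1z addr0 (_ : O = s i) ?upd_id //.
apply: (@homog_inj R N); rewrite hO (bigD1 i) //= big1 => [|n ni].
  by rewrite l1 scale1r addr0.
by rewrite l0 // scale0r.
Qed.

End Simple.

(** * Affine functionals and embeddings *)

Section Functionals.
Variables (R : realType) (N : nat).
Local Notation V := 'rV[R]_N.
Implicit Types (x y : V) (w : 'cV[R]_(1 + N)).

Lemma evE w x : ev w x = w (lshift N 0) 0 + \sum_j x 0 j * w (rshift 1 j) 0.
Proof.
rewrite /ev mxE big_split_ord /= big_ord1 row_mxEl mxE mul1r; congr +%R.
by apply: eq_bigr => j _; rewrite row_mxEr.
Qed.

Lemma ev0 w : ev w 0 = w (lshift N 0) 0.
Proof. by rewrite evE big1 ?addr0 // => j _; rewrite mxE mul0r. Qed.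

Lemma ev_inj w w' : ev w =1 ev w' -> w = w'.
Proof.
move=> H; have H0 : w (lshift N 0) 0 = w' (lshift N 0) 0 by rewrite -!ev0.
apply/colP => i; case: (split_ordP i) => j ->; first by rewrite (ord1 j).
have := H (delta_mx 0 j); rewrite !evE H0 => /addrI.
rewrite (bigD1 j) //= [in X in _ = X](bigD1 j) //= !mxE !eqxx !mul1r.
by rewrite !big1 ?addr0 // => k kj; rewrite mxE (negPf kj) andbF mul0r.
Qed.

Lemma evZ a w x : ev (a *: w) x = a * ev w x.
Proof. by rewrite /ev -scalemxAr mxE. Qed.

Lemma evN w x : ev (- w) x = - ev w x.
Proof. by rewrite -scaleN1r evZ mulN1r. Qed.

Lemma ev_comb k (s : 'I_k -> V) (l : 'I_k -> R) w x :
  homog x = \sum_i l i *: homog (s i) -> ev w x = \sum_i l i * ev w (s i).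
Proof.
rewrite /ev => ->; rewrite mulmx_suml summxE; apply: eq_bigr => i _.
by rewrite -scalemxAl mxE.
Qed.

Lemma ev_comb2 w (a b : R) x y : a + b = 1 ->
  ev w (a *: x + b *: y) = a * ev w x + b * ev w y.
Proof. by move=> ab; rewrite /ev homog_comb2 // mulmxDl -!scalemxAl !mxE. Qed.

Lemma ev_shrink w (d : R) x : ev w ((1 - d) *: x) = (1 - d) * ev w x + d * ev w 0.
Proof. by rewrite -ev_comb2 ?subrK // scaler0 addr0. Qed.

(** The j-th barycentric coordinate as an affine functional: for independent [s] the pseudo-inverse
    is a right inverse of [homogm s]. This determines the functional only on the flat spanned by
    [s]. *)
Definition bary k (s : 'I_k -> V) (j : 'I_k) : 'cV[R]_(1 + N) :=
  col j (pinvmx (homogm s)).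

Lemma ev_col p (A : 'M[R]_(1 + N, p)) j x : ev (col j A) x = (homog x *m A) 0 j.
Proof. by rewrite /ev !mxE; apply: eq_bigr => i _; rewrite [col _ _ _ _]mxE. Qed.

Lemma bary_coord k (s : 'I_k -> V) (l : 'I_k -> R) x j : affinely_independent s ->
  homog x = \sum_i l i *: homog (s i) -> ev (bary s j) x = l j.
Proof.
move=> /aind_row_free sI hx; rewrite ev_col hx.
have -> : \sum_i l i *: homog (s i) = (\row_i l i) *m homogm s.
  by rewrite homogm_comb; apply: eq_bigr => i _; rewrite mxE.
by rewrite -mulmxA mulmxVp // mulmx1 mxE.
Qed.

Lemma bary_vertex k (s : 'I_k -> V) i j : affinely_independent s ->
  ev (bary s j) (s i) = (j == i)%:R.
Proof. by move=> sI; rewrite (bary_coord j sI (homog_comb_homog s i)). Qed.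

Lemma bary_comb k (s : 'I_k -> V) x : (homog x <= homogm s)%MS ->
  homog x = \sum_j ev (bary s j) x *: homog (s j).
Proof.
move=> /mulmxKpV {1}<-; rewrite homogm_comb; apply: eq_bigr => j _.
by rewrite ev_col.
Qed.

Lemma homog_comb_sub k (s : 'I_k -> V) (l : 'I_k -> R) x :
  homog x = \sum_i l i *: homog (s i) -> (homog x <= homogm s)%MS.
Proof.
move=> ->; apply: summx_sub => i _; apply: scalemx_sub.
by rewrite -(rowK (fun i => homog (s i))) row_sub.
Qed.

Lemma bary_neq0 k (s : 'I_k -> V) j : affinely_independent s -> bary s j != 0.
Proof.
move=> sI; apply/eqP => b0; have := bary_vertex j j sI.
by rewrite b0 /ev mulmx0 mxE eqxx => /eqP; rewrite eq_sym oner_eq0.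
Qed.

Lemma fhull_bary k (s : 'I_k -> V) x : affinely_independent s ->
  (homog x <= homogm s)%MS -> fhull s x <-> forall j, 0 <= ev (bary s j) x.
Proof.
move=> sI sx; split=> [[l [l0 hx]] j|H]; first by rewrite (bary_coord j sI hx).
by exists (fun j => ev (bary s j) x); split=> //; exact: bary_comb.
Qed.

Lemma fhull_facet k (s : 'I_k.+1 -> V) j x : affinely_independent s ->
  ev (bary s j) x = 0 -> fhull (s \o lift j) x <-> fhull s x.
Proof.
move=> sI bx; split; first exact/fhull_range/range_comp_sub.
move=> [l [l0 hx]]; exists (l \o lift j); split=> [i|]; first exact: l0.
by rewrite hx (bigD1_ord j) //= -(bary_coord j sI hx) bx scale0r add0r.
Qed.

(** Along the line through the origin and x the product is a^2 + d q, with a the value at x, hence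
    positive while |d q| < a^2. The bound a^2 / (|q| + 1) also covers q = 0. *)
Lemma small_shrink (ws : seq 'cV[R]_(1 + N)) x : exists2 e : R, 0 < e &
  forall d, `|d| <= e -> forall w, w \in ws -> ev w x != 0 ->
    0 < ev w x * ev w ((1 - d) *: x).
Proof.
elim: ws => [|w ws [e e0 IH]]; first by exists 1.
pose a := ev w x; pose q := a * (ev w 0 - a).
have [a0|an] := eqVneq a 0.
  by exists e => // d /IH H w'; rewrite inE => /orP[/eqP->|/H//]; rewrite -/a a0 eqxx.
have a2 : 0 < a ^+ 2 by rewrite exprn_even_gt0.
have q1 : 0 < `|q| + 1 by rewrite ltr_wpDl.
exists (Num.min e (a ^+ 2 / (`|q| + 1))); first by rewrite lt_min e0 divr_gt0.
move=> d; rewrite le_min => /andP[/IH H dq] w'; rewrite inE => /orP[/eqP->|/H//] _.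
rewrite ev_shrink -/a.
have -> : a * ((1 - d) * a + d * ev w 0) = a ^+ 2 + d * q by rewrite /q; ring.
rewrite -ltrBlDl sub0r ltrNl; apply: le_lt_trans (ler_norm _) _.
rewrite normrN normrM; move: dq; rewrite ler_pdivlMr // => dq.
have [->|qn] := eqVneq q 0; first by rewrite normr0 mulr0.
case: (eqVneq d 0) => [->|dn]; first by rewrite normr0 mul0r.
apply: lt_le_trans dq; rewrite ltr_pM2l ?normr_gt0 //; by rewrite ltrDl.
Qed.

End Functionals.

Section AffineEmbedding.
Variables (R : realType) (n N : nat) (E : 'M[R]_(1 + n, 1 + N))
  (f : 'rV[R]_n -> 'rV[R]_N).
Hypotheses (E_free : row_free E) (fE : forall y, homog (f y) = homog y *m E).

Lemma ev_embed w y : ev w (f y) = ev (E *m w) y.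
Proof. by rewrite /ev fE mulmxA. Qed.

Lemma embed_comb k (t : 'I_k -> 'rV_n) (l : 'I_k -> R) :
  \sum_i l i *: homog (f (t i)) = (\sum_i l i *: homog (t i)) *m E.
Proof. by rewrite mulmx_suml; apply: eq_bigr => i _; rewrite fE scalemxAl. Qed.

Lemma aind_embed k (t : 'I_k -> 'rV_n) :
  affinely_independent (f \o t) <-> affinely_independent t.
Proof.
split=> /aindP H; apply/aindP => l l0; apply: H.
  by rewrite embed_comb l0 mul0mx.
by move: l0; rewrite embed_comb -[RHS](mul0mx _ E) => /(row_free_inj E_free).
Qed.

Lemma fhull_embed k (t : 'I_k -> 'rV_n) y : fhull (f \o t) (f y) <-> fhull t y.
Proof.
split=> -[l [l0 hy]]; exists l; split=> //.
  by move: hy; rewrite embed_comb fE => /(row_free_inj E_free).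
by rewrite embed_comb fE hy.
Qed.

Lemma embed_comb2 (a b : R) x y : a + b = 1 -> f (a *: x + b *: y) = a *: f x + b *: f y.
Proof.
move=> ab; apply: homog_inj.
by rewrite fE !homog_comb2 // !fE mulmxDl !scalemxAl.
Qed.

Lemma image_range k (t : 'I_k -> 'rV[R]_n) : f @` range t = range (f \o t).
Proof. by rewrite image_comp. Qed.

End AffineEmbedding.

(** Affine coordinates on the flat spanned by [s0]: the origin is [s0 ord0], the basis consists of
    the edges from it, and g inverts f on the flat. This moves full-dimensional arguments into any
    flat. *)
Lemma flat_param (R : realType) n N (s0 : 'I_n.+1 -> 'rV[R]_N) :
  affinely_independent s0 ->
  exists (E : 'M[R]_(1 + n, 1 + N)) (f : 'rV[R]_n -> 'rV[R]_N) (g : 'rV[R]_N -> 'rV[R]_n),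
    [/\ row_free E, (forall y, homog (f y) = homog y *m E), (E :=: homogm s0)%MS &
        forall x, (homog x <= homogm s0)%MS -> f (g x) = x].
Proof.
move=> sI; pose p := s0 ord0; pose K := \matrix_(k < n) (s0 (lift ord0 k) - p).
pose E : 'M[R]_(1 + n, 1 + N) := col_mx (homog p) (row_mx 0 K).
pose f y := p + y *m K; pose g x := rsubmx (homog x *m pinvmx E).
have fE y : homog (f y) = homog y *m E.
  rewrite /E /homog mul_row_col (_ : const_mx 1 = 1%:M); last first.
    by apply/matrixP => i j; rewrite !ord1 !mxE eqxx.
  by rewrite mul1mx mul_mx_row mulmx0 add_row_mx addr0.
have rowB k : row k (row_mx (0 : 'M[R]_(n, 1)) K) = homog (s0 (lift ord0 k)) - homog p.
  rewrite row_row_mx row0 rowK /homog opp_row_mx add_row_mx subrr //.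
have homs k : (homog (s0 k) <= homogm s0)%MS.
  by rewrite -(rowK (fun i => homog (s0 i))) row_sub.
have EE : (E :=: homogm s0)%MS.
  apply/eqmxP/andP; split.
    rewrite col_mx_sub homs; apply/row_subP => k; rewrite rowB.
    by rewrite addmx_sub ?(eqmx_opp (homog p)) ?homs.
  apply/row_subP => k; rewrite rowK; case: (unliftP ord0 k) => [k'|] ->.
    rewrite -(subrK (homog p) (homog _)) -rowB.
    have : (row_mx (0 : 'M[R]_(n, 1)) K <= E)%MS by rewrite -addsmxE addsmxSr.
    have : (homog p <= E)%MS by rewrite -addsmxE addsmxSl.
    move=> H1 H2; rewrite addmx_sub //; apply: submx_trans H2; exact: row_sub.
  by rewrite -addsmxE addsmxSl.
have Ef : row_free E by rewrite /row_free EE; exact/aind_row_free.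
exists E, f, g; split=> // x xs; apply: homog_inj; rewrite fE.
rewrite -EE in xs; rewrite -[RHS](mulmxKpV xs); congr (_ *m _).
(* The first coordinate of the preimage is 1, since only the first row of E has a nonzero first
   entry. *)
rewrite -[RHS]hsubmxK /homog; congr row_mx; apply/matrixP => i j; rewrite !ord1 mxE.
have := mulmxKpV xs; move: (homog x *m pinvmx E) => u.
rewrite -{1}[u]hsubmxK mul_row_col /homog mul_mx_row mul_mx_row mulmx0 add_row_mx addr0.
by move=> /eq_row_mx[/matrixP /(_ 0 0)]; rewrite !mxE big_ord1 !mxE mulr1 => ->.
Qed.

(** * Relations between full-dimensional simplices *)

Definition ind (T : Type) (A : set T) (x : T) : int := `[< A x >]%:R.

Lemma ind_eq (T U : Type) (A : set T) (B : set U) x y :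
  (A x <-> B y) -> ind A x = ind B y.
Proof. by move=> AB; rewrite /ind (asbool_equiv_eq AB). Qed.

Lemma sum_by_key (G : zmodType) (I : finType) (T : eqType) (key : I -> T) (F : I -> G) :
  (forall v, \sum_(i | key i == v) F i = 0) -> \sum_i F i = 0.
Proof.
move=> H.
transitivity (\sum_i \sum_(v <- undup (codom key)) if key i == v then F i else 0).
  apply: eq_bigr => i _; rewrite (bigD1_seq (key i)) ?undup_uniq ?mem_undup ?codom_f //=.
  by rewrite eqxx big1 ?addr0 // => v; rewrite eq_sym => /negPf ->.
by rewrite exchange_big big1 //= => v _; rewrite -big_mkcond.
Qed.

(** * The jump of a simplex across a wall *)

Section Jump.
Variables (R : realType) (n : nat).
Local Notation V := 'rV[R]_n.+1.

Lemma homog_full (m : nat) (s : 'I_m.+1 -> 'rV[R]_m) x : affinely_independent s ->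
  (homog x <= homogm s)%MS.
Proof.
move=> /aind_row_free sI; apply: submx_full; rewrite -sub1mx.
by move: sI; rewrite row_free_unit => sI; rewrite sub1mx row_full_unit.
Qed.

(* The facet of s opposite to the vertex j spans the hyperplane k = 0, where the
   functional k is normalized to be 1 at the origin. *)
Definition on_wall (s : 'I_n.+2 -> V) (k : 'cV[R]_(1 + n.+1)) (j : 'I_n.+2) : bool :=
  (ev (bary s j) 0 != 0) && ((ev (bary s j) 0)^-1 *: bary s j == k).

Variables (k : 'cV[R]_(1 + n.+1)) (s : 'I_n.+2 -> V).
Hypotheses (k0 : ev k 0 = 1) (sI : affinely_independent s).

Lemma on_wallP j : reflect (exists a, bary s j = a *: k) (on_wall s k j).
Proof.
apply: (iffP andP) => [[b0 /eqP <-]|[a ha]].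
  by exists (ev (bary s j) 0); rewrite scalerA divff // scale1r.
have b0 : ev (bary s j) 0 = a by rewrite ha evZ k0 mulr1.
have an : a != 0 by apply: contraNneq (bary_neq0 j sI); rewrite ha => ->; rewrite scale0r.
by rewrite b0 an ha scalerA mulVf // scale1r eqxx.
Qed.

Lemma on_wall_ev j x : on_wall s k j -> ev (bary s j) x = ev (bary s j) 0 * ev k x.
Proof. by case/on_wallP => a ->; rewrite !evZ k0 mulr1. Qed.

(** For i different from j, the vertex [s j] lies on the facet opposite to [s i] but not in the
    plane of the facet opposite to itself. *)
Lemma on_wall_uniq i j : on_wall s k i -> on_wall s k j -> i = j.
Proof.
move=> iw jw; apply/eqP; apply/negPn/negP => ij.
have := bary_vertex j i sI; rewrite (negPf ij) (on_wall_ev _ iw) => /eqP.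
have [/negPf bi _] := andP iw; rewrite mulf_eq0 bi /= => /eqP kj.
have := bary_vertex j j sI; rewrite eqxx (on_wall_ev _ jw) kj mulr0 => /eqP.
by rewrite eq_sym oner_eq0.
Qed.

(* All facets of s but the one in the wall are far from x, so only that one is
   crossed when moving radially from (1 + d) x to (1 - d) x. *)
Lemma simplex_jump x d : ev k x = 0 -> 0 < d ->
  (forall j, ~~ on_wall s k j -> 0 < ev (bary s j) x * ev (bary s j) ((1 - d) *: x)) ->
  (forall j, ~~ on_wall s k j -> 0 < ev (bary s j) x * ev (bary s j) ((1 - (- d)) *: x)) ->
  ind (fhull s) ((1 - d) *: x) - ind (fhull s) ((1 - (- d)) *: x) =
  \sum_(j | on_wall s k j) sgz (ev (bary s j) 0) * ind (fhull (s \o lift j)) x.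
Proof.
move=> kx d0 Hp Hn.
have hull y : fhull s y <-> forall j, 0 <= ev (bary s j) y.
  by apply: fhull_bary => //; exact: homog_full.
have sgn a b : 0 < a * b :> R -> (0 <= b) = (0 <= a).
  move=> ab; case: (ltrgtP a 0) ab => [a0|a0|->]; last by rewrite mul0r ltxx.
    by rewrite nmulr_rgt0 // => b0; rewrite leNgt b0.
  by rewrite pmulr_rgt0 // => b0; rewrite ltW.
have [[j jw]|none] := pselect (exists j, on_wall s k j); last first.
  rewrite big1 => [|j jw]; last by case: none; exists j.
  apply/eqP; rewrite subr_eq0; apply/eqP/ind_eq; rewrite !hull.
  have nw j : ~~ on_wall s k j by apply/negP => jw; apply: none; exists j.
  split=> H j; first by rewrite (sgn _ _ (Hn j (nw j))) -(sgn _ _ (Hp j (nw j))).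
  by rewrite (sgn _ _ (Hp j (nw j))) -(sgn _ _ (Hn j (nw j))).
have nw i : i != j -> ~~ on_wall s k i.
  by apply: contraNN => iw; apply/eqP; exact: on_wall_uniq.
rewrite (big_pred1 j) => [|i]; last first.
  rewrite /=; apply/idP/eqP => [iw|->//]; exact: on_wall_uniq.
have bx : ev (bary s j) x = 0 by rewrite on_wall_ev // kx mulr0.
rewrite (@ind_eq _ _ (fhull (s \o lift j)) (fhull s) x x); last exact: fhull_facet.
have [bn _] := andP jw.
(* As x is on the wall, the j-th coordinate of (1 - e) x is e times that of the origin; the other
   coordinates keep their signs. *)
have shr (e : R) : (forall i, i != j -> 0 < ev (bary s i) x * ev (bary s i) ((1 - e) *: x)) ->
    fhull s ((1 - e) *: x) <-> fhull s x /\ 0 <= e * ev (bary s j) 0.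
  move=> He; rewrite !hull; split=> [H|[H e0] i].
    split=> [i|]; last by have := H j; rewrite ev_shrink bx mulr0 add0r.
    by case: (eqVneq i j) => [->|ij]; rewrite ?bx // -(sgn _ _ (He _ ij)).
  case: (eqVneq i j) => [->|ij]; first by rewrite ev_shrink bx mulr0 add0r.
  by rewrite (sgn _ _ (He _ ij)).
have {}Hp := shr d (fun i ij => Hp i (nw i ij)).
have {}Hn := shr (- d) (fun i ij => Hn i (nw i ij)).
rewrite /ind (asbool_equiv_eq Hp) (asbool_equiv_eq Hn) !asbool_and.
rewrite !asboolb mulNr oppr_ge0 pmulr_rge0 // pmulr_rle0 //.
case: (ltrgtP (ev (bary s j) 0) 0) bn => // b0 _; rewrite !(andbF, andbT) /=.
  by rewrite ltr0_sgz // mulN1r sub0r.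
by rewrite gtr0_sgz // mul1r subr0.
Qed.

End Jump.

Lemma ev_neq0_dim0 (R : realType) (y : 'rV[R]_0) w :
  w != 0 -> ev w y != 0.
Proof.
apply: contra_neq => wy; apply: ev_inj => x.
by rewrite (thinmx0 x) -(thinmx0 y) wy /ev mulmx0 mxE.
Qed.

(** * Cones over the facets in a wall, and the induction step *)

Section InductionStep.
Variables (R : realType) (n : nat) (G : zmodType).
Local Notation V := 'rV[R]_n.+1.

Definition cone_map (f : 'rV[R]_n -> V) m (t : 'I_m -> 'rV[R]_n) : 'I_m.+1 -> V :=
  fun k => if unlift ord0 k is Some k' then f (t k') else 0.

Lemma range_cone (f : 'rV[R]_n -> V) m (t : 'I_m -> 'rV[R]_n) :
  range (cone_map f t) = [set 0] `|` f @` range t.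
Proof.
apply/seteqP; split=> [_ [k _ <-]|x].
  rewrite /cone_map; case: unliftP => [k' _|_]; last by left.
  by right; exists (t k').
case=> [->|[_ [k _ <-] <-]].
  by exists ord0 => //; rewrite /cone_map unlift_none.
by exists (lift ord0 k) => //; rewrite /cone_map liftK.
Qed.

Lemma cone_upd (f : 'rV[R]_n -> V) m (t : 'I_m -> 'rV[R]_n) i z :
  cone_map f (upd t i z) = upd (cone_map f t) (lift ord0 i) (f z).
Proof.
apply/funext => k; rewrite /cone_map /upd; case: (unliftP ord0 k) => [k'|] ->.
  by rewrite (inj_eq lift_inj); case: eqP.
by rewrite (negPf (neq_lift _ _)).
Qed.

Variable (mu : set V -> G).
Hypothesis muA : simple_additive n.+2 mu.

(** Cutting an edge of the base cuts the cone along the same edge. The apex is independent of the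
    base because k is 1 at the apex and 0 on the base. *)
Lemma simple_cone (E : 'M[R]_(1 + n, 1 + n.+1)) f (k : 'cV[R]_(1 + n.+1)) :
  row_free E -> (forall y, homog (f y) = homog y *m E) ->
  ev k 0 = 1 -> (forall y, ev k (f y) = 0) ->
  simple_additive n.+1 (fun X : set 'rV[R]_n => mu ([set 0] `|` f @` X)).
Proof.
move=> Ef fE k0 kf t i j a z tI ij a01 hz.
rewrite -!range_cone !cone_upd; apply: (muA (t := a)) => //.
- apply/aindP => l; rewrite big_ord_recl => l0.
  have lf m : cone_map f t (lift ord0 m) = f (t m) by rewrite /cone_map liftK.
  have c0 : cone_map f t ord0 = 0 by rewrite /cone_map unlift_none.
  have {}l0 : l ord0 *: homog 0 + \sum_m l (lift ord0 m) *: homog (f (t m)) = 0.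
    by rewrite -[RHS]l0 c0; congr +%R; apply: eq_bigr => m _; rewrite lf.
  have l00 : l ord0 = 0.
    have := congr1 (fun u : 'rV_(1 + n.+1) => (u *m k) 0 0) l0.
    rewrite mulmxDl mul0mx mulmx_suml mxE -scalemxAl mxE -/(ev k 0) k0 mulr1.
    rewrite summxE big1 => [|m _]; first by rewrite addr0 mxE.
    by rewrite -scalemxAl mxE -/(ev k (f _)) kf mulr0.
  move: l0; rewrite l00 scale0r add0r => l0 m.
  case: (unliftP ord0 m) => [m'|] -> //.
  by move/(aind_embed Ef fE)/aindP: tI => /(_ (l \o lift ord0)); apply.
- by rewrite /cone_map !liftK hz (embed_comb2 fE) // subrK.
Qed.

Hypothesis IH : forall (nu : set 'rV[R]_n -> G), simple_additive n.+1 nu ->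
  forall (I : finType) (c : I -> int) (s : I -> 'I_n.+1 -> 'rV[R]_n)
    (ws : seq 'cV[R]_(1 + n)),
  (forall i, c i != 0 -> affinely_independent (s i)) ->
  (forall w, w \in ws -> w != 0) ->
  (forall y, (forall w, w \in ws -> ev w y != 0) ->
     \sum_i c i * ind (fhull (s i)) y = 0) ->
  \sum_i nu (range (s i)) *~ c i = 0.

Variables (I : finType) (c : I -> int) (s : I -> 'I_n.+2 -> V)
  (ws : seq 'cV[R]_(1 + n.+1)).
Hypotheses (sI : forall i, c i != 0 -> affinely_independent (s i))
  (ws0 : forall w, w \in ws -> w != 0)
  (sum0 : forall y, (forall w, w \in ws -> ev w y != 0) ->
     \sum_i c i * ind (fhull (s i)) y = 0).

(** Pulled back to coordinates on the wall, the facets in it satisfy a relation almost everywhere,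
    and [IH] applies to the simple valuation that takes the cone over a facet. *)
Lemma wall_relation (k : 'cV[R]_(1 + n.+1)) :
  \sum_(p : I * 'I_n.+2 | (c p.1 != 0) && on_wall (s p.1) k p.2)
    mu (range (upd (s p.1) p.2 0)) *~ (c p.1 * sgz (ev (bary (s p.1) p.2) 0)) = 0.
Proof.
have [[[i0 j0] /= p0]|none] := pselect (exists p : I * 'I_n.+2,
    (c p.1 != 0) && on_wall (s p.1) k p.2); last first.
  by rewrite big1 // => p pP; case: none; exists p.
have [c0 w0] := andP p0; have s0I := sI c0.
have k0 : ev k 0 = 1.
  by case/andP: w0 => b0 /eqP <-; rewrite evZ mulVf.
have fI : affinely_independent (s i0 \o lift j0).
  by apply: aind_comp s0I; exact: lift_inj.
have [E [f [g [Ef fE EE fg]]]] := flat_param fI.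
have in_flat x : ev k x = 0 -> (homog x <= homogm (s i0 \o lift j0))%MS.
  move=> kx; have := bary_comb (homog_full x s0I).
  rewrite (bigD1_ord j0) //= (on_wall_ev k0 s0I _ w0) kx mulr0 scale0r add0r => hx.
  exact: (@homog_comb_sub _ _ _ (s i0 \o lift j0) _ _ hx).
have kf y : ev k (f y) = 0.
  have : (homog (f y) <= homogm (s i0 \o lift j0))%MS by rewrite -EE fE submxMl.
  move=> /bary_comb /(ev_comb k) ->; apply: big1 => m _.
  have := bary_vertex (lift j0 m) j0 s0I.
  rewrite (on_wall_ev k0 s0I _ w0) (negPf (neq_lift _ _)) => /eqP.
  by rewrite mulf_eq0; case/andP: w0 => /negPf -> _ /= /eqP ->; rewrite mulr0.
(* A functional vanishing on the wall is a multiple of k, since [s i0 j0] is the only vertex of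
   [s i0] off the wall. *)
have prop w : E *m w = 0 -> forall y, ev w y = ev w 0 * ev k y.
  move=> Ew; have wl m : ev w (s i0 (lift j0 m)) = 0.
    have hm : (homog (s i0 (lift j0 m)) <= homogm (s i0 \o lift j0))%MS.
      apply: in_flat; have := bary_vertex (lift j0 m) j0 s0I.
      rewrite (on_wall_ev k0 s0I _ w0) (negPf (neq_lift _ _)) => /eqP.
      by rewrite mulf_eq0; case/andP: w0 => /negPf -> _ /= /eqP.
    by rewrite -(fg _ hm) (ev_embed fE) Ew /ev mulmx0 mxE.
  have wE y : ev w y = ev (bary (s i0) j0) 0 * ev w (s i0 j0) * ev k y.
    rewrite (ev_comb w (bary_comb (homog_full y s0I))) (bigD1_ord j0) //=.
    rewrite big1 => [|m _]; last by rewrite wl mulr0.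
    by rewrite addr0 (on_wall_ev k0 s0I _ w0) mulrAC.
  by move=> y; rewrite [LHS]wE (wE 0) k0 mulr1.
pose bs := [seq bary (s p.1) p.2 | p <- enum {: I * 'I_n.+2} & c p.1 != 0].
(* The exceptional functionals and all facet functionals, restricted to the wall. Those restricting
   to 0 are multiples of k and are filtered out. *)
pose ws' := [seq w <- [seq E *m w | w <- ws ++ bs] | w != 0].
pose c' (p : I * 'I_n.+2) : int := if (c p.1 != 0) && on_wall (s p.1) k p.2
  then c p.1 * sgz (ev (bary (s p.1) p.2) 0) else 0.
pose t (p : I * 'I_n.+2) : 'I_n.+1 -> 'rV[R]_n := g \o (s p.1 \o lift p.2).
have ft p : (c p.1 != 0) && on_wall (s p.1) k p.2 -> f \o t p = s p.1 \o lift p.2.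
  move=> /andP[/sI s1I w1]; apply/funext => m /=; apply: fg; apply: in_flat.
  have := bary_vertex (lift p.2 m) p.2 s1I.
  rewrite (on_wall_ev k0 s1I _ w1) (negPf (neq_lift _ _)) => /eqP.
  by rewrite mulf_eq0; case/andP: w1 => /negPf -> _ /= /eqP.
have := IH (simple_cone Ef fE k0 kf) (c := c') (s := t) (ws := ws').
move=> H; rewrite -[RHS]H {H}.
- rewrite [LHS]big_mkcond; apply: eq_bigr => p _; rewrite /c'.
  case: ifP => // pP.
  congr (mu _ *~ _); rewrite image_range ft //.
  apply/seteqP; split=> [_ [m _ <-]|x].
    rewrite /upd; case: eqP => [_|/eqP mp]; first by left.
    case: (unliftP p.2 m) mp => [m' ->|->]; last by rewrite eqxx.
    by right; exists m'.
  case=> [->|[m _ <-]]; first by exists p.2; rewrite // upd_same.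
  by exists (lift p.2 m); rewrite // upd_other // eq_sym neq_lift.
- move=> p; rewrite /c'; case: ifP => [pP _|_]; last by rewrite eqxx.
  apply/(aind_embed Ef fE); rewrite ft //; apply: aind_comp; first exact: lift_inj.
  by apply: sI; case/andP: pP.
- by move=> w; rewrite mem_filter => /andP[].
move=> y hy; set x := f y.
have kx : ev k x = 0 by exact: kf.
have gen w : w \in ws ++ bs -> ev w x != 0 \/ forall z, ev w z = ev w 0 * ev k z.
  move=> wb; have [Ew|Ew] := eqVneq (E *m w) 0; first by right; exact: prop.
  by left; rewrite (ev_embed fE); apply: hy; rewrite mem_filter Ew map_f.
have [e e0 He] := small_shrink (ws ++ bs) x.
have bsP i j : c i != 0 -> bary (s i) j \in ws ++ bs.
  move=> ci; rewrite mem_cat; apply/orP; right.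
  by apply/mapP; exists (i, j); rewrite // mem_filter mem_enum /= ci.
have nowall i j : c i != 0 -> ~~ on_wall (s i) k j -> ev (bary (s i) j) x != 0.
  move=> ci; have [//|H] := gen _ (bsP i j ci).
  suff -> : on_wall (s i) k j by [].
  apply/(on_wallP k0 (sI ci)); exists (ev (bary (s i) j) 0).
  by apply: ev_inj => z; rewrite evZ.
(* At (1 - d) x the functional k takes the value d, so multiples of k do not vanish there;
   functionals nonzero at x keep their sign. Hence the point is not exceptional. *)
have zero d : `|d| <= e -> d != 0 -> \sum_i c i * ind (fhull (s i)) ((1 - d) *: x) = 0.
  move=> de dn; apply: sum0 => w ww.
  have wb : w \in ws ++ bs by rewrite mem_cat ww.
  have [wx|wk] := gen w wb.
    by have := He d de w wb wx; apply: contraTneq => ->; rewrite mulr0 ltxx.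
  rewrite ev_shrink (wk x) kx !mulr0 add0r mulf_neq0 //.
  apply: contraNneq (ws0 ww) => w00; apply/eqP/ev_inj => z.
  by rewrite wk w00 mul0r /ev mulmx0 mxE.
have ee : `|e| <= e by rewrite gtr0_norm.
have nee : `|- e| <= e by rewrite normrN.
have en : e != 0 by rewrite gt_eqF.
have nen : - e != 0 by rewrite oppr_eq0.
(* The relation on the wall is the difference of the given relation at two points on opposite sides
   of it. *)
transitivity (\sum_i c i * (ind (fhull (s i)) ((1 - e) *: x) -
                            ind (fhull (s i)) ((1 - (- e)) *: x))); last first.
  by under eq_bigr do rewrite mulrBr; rewrite sumrB (zero _ ee en) (zero _ nee nen) subrr.
rewrite -(pair_bigA _ (fun i j => c' (i, j) * ind (fhull (t (i, j))) y)) /=.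
apply: eq_bigr => i _; have [ci|ci] := eqVneq (c i) 0.
  by rewrite ci mul0r big1 // => j _; rewrite /c' /= ci eqxx /= mul0r.
rewrite (simplex_jump k0 (sI ci) kx e0) => [|j jw|j jw]; first last.
- by apply: He => //; [exact: bsP|exact: nowall].
- by apply: He => //; [exact: bsP|exact: nowall].
rewrite mulr_sumr [RHS]big_mkcond; apply: eq_bigr => j _; rewrite /c' /= ci /=.
case: ifP => jw; last by rewrite mul0r.
rewrite -mulrA; congr (_ * (_ * _)); apply: ind_eq.
by rewrite -(fhull_embed Ef fE) ft //= ci.
Qed.

(** Each simplex is expanded by [cone_formula] with apex 0, and the resulting facets are grouped by
    their normalized functionals. *)
Lemma simple_relation_step : \sum_i mu (range (s i)) *~ c i = 0.
Proof.
pose F (p : I * 'I_n.+2) :=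
  mu (range (upd (s p.1) p.2 0)) *~ (c p.1 * sgz (ev (bary (s p.1) p.2) 0)).
transitivity (\sum_p F p).
  rewrite -(pair_bigA _ (fun i j => F (i, j))); apply: eq_bigr => i _.
  have [ci|ci] := eqVneq (c i) 0.
    by rewrite ci mulr0z big1 // => j _; rewrite /F /= ci mul0r mulr0z.
  rewrite (cone_formula muA (sI ci) (bary_comb (homog_full 0 (sI ci)))).
  by rewrite mulrz_suml; apply: eq_bigr => j _; rewrite /F /= -mulrzA mulrC.
apply: (sum_by_key (key := fun p : I * 'I_n.+2 =>
  (ev (bary (s p.1) p.2) 0)^-1 *: bary (s p.1) p.2)) => k.
rewrite -[RHS](wall_relation k) [LHS]big_mkcond [RHS]big_mkcond.
apply: eq_bigr => p _; rewrite /on_wall.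
have [cp|cp] := eqVneq (c p.1) 0; first by rewrite /F cp mul0r mulr0z if_same.
(* A facet whose plane passes through the origin has no normalized functional and gets the key 0,
   but its term carries the sign 0. *)
have [b0|b0] := eqVneq (ev (bary (s p.1) p.2) 0) 0 => //=.
by rewrite /F b0 sgz0 mulr0 mulr0z if_same.
Qed.

End InductionStep.

(* The functionals ws are the exceptional hyperplanes: the relation is only assumed
   almost everywhere. *)
Theorem simple_relation (R : realType) n (G : zmodType) (mu : set 'rV[R]_n -> G) :
  simple_additive n.+1 mu ->
  forall (I : finType) (c : I -> int) (s : I -> 'I_n.+1 -> 'rV[R]_n)
    (ws : seq 'cV[R]_(1 + n)),
  (forall i, c i != 0 -> affinely_independent (s i)) ->
  (forall w, w \in ws -> w != 0) ->
  (forall y, (forall w, w \in ws -> ev w y != 0) ->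
     \sum_i c i * ind (fhull (s i)) y = 0) ->
  \sum_i mu (range (s i)) *~ c i = 0.
Proof.
elim: n mu => [|n IH] mu muA I c s ws sI ws0 sum0; last first.
  exact: (simple_relation_step muA IH sI ws0 sum0).
(* In dimension 0 the only point lies on no exceptional hyperplane and in every simplex, so the
   relation there says that the coefficients sum to 0. *)
have sum1 : \sum_i c i = 0.
  rewrite -[RHS](sum0 0) => [|w ww]; last by apply: ev_neq0_dim0 => //; exact: ws0.
  apply: eq_bigr => i _; rewrite /ind asboolT ?mulr1 //.
  by have := mem_fhull (s i) ord0; rewrite thinmx0.
transitivity (\sum_i mu [set 0] *~ c i).
  apply: eq_bigr => i _; congr (mu _ *~ _).
  apply/seteqP; split=> [x _|x ->]; first by rewrite [x]thinmx0.
  by exists ord0; rewrite // thinmx0.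
by rewrite -mulrz_sumr sum1 mulr0z.
Qed.

(** * Quotient of an abelian group *)

Section ZmodQuotient.
Local Open Scope quotient_scope.
Variables (U : zmodType) (K : set U).
Hypotheses (K0 : K 0) (KB : forall x y, K x -> K y -> K (x - y)).

Definition sub_equiv (x y : U) : bool := `[< K (x - y) >].

Lemma subgroupN x : K x -> K (- x).
Proof. by move=> Kx; rewrite -sub0r; exact: KB. Qed.

Lemma subgroupD x y : K x -> K y -> K (x + y).
Proof. by move=> Kx Ky; rewrite -[y]opprK; apply: KB => //; exact: subgroupN. Qed.

Lemma sub_equiv_is_equiv : equiv_class_of sub_equiv.
Proof.
split=> [x|x y|y x z]; rewrite /sub_equiv.
- by rewrite subrr; exact/asboolP.
- by apply/asbool_equiv_eq; split=> /subgroupN; rewrite opprB.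
- move=> /asboolP xy /asboolP yz; apply/asboolP.
  by rewrite -(subrK y x) -addrA; exact: subgroupD.
Qed.

Canonical sub_equiv_rel := EquivRelPack sub_equiv_is_equiv.

Definition zquot := {eq_quot sub_equiv_rel}.
HB.instance Definition _ := Choice.on zquot.
HB.instance Definition _ := EqQuotient.on zquot.

Definition zq_pi (x : U) : zquot := \pi_zquot x.

Lemma zq_piP x y : zq_pi x = zq_pi y <-> K (x - y).
Proof. by split=> [/eqmodP /asboolP|H]; last by apply/eqmodP/asboolP. Qed.

Lemma zq_repr x : K (repr (zq_pi x) - x).
Proof. by apply/zq_piP; rewrite /zq_pi reprK. Qed.

Definition zq_add (a b : zquot) := zq_pi (repr a + repr b).
Definition zq_opp (a : zquot) := zq_pi (- repr a).

Lemma zq_addE x y : zq_add (zq_pi x) (zq_pi y) = zq_pi (x + y).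
Proof. by apply/zq_piP; rewrite opprD addrACA; apply: subgroupD; exact: zq_repr. Qed.

Lemma zq_oppE x : zq_opp (zq_pi x) = zq_pi (- x).
Proof. by apply/zq_piP; rewrite -opprD; apply: subgroupN; exact: zq_repr. Qed.

Lemma zq_ind (P : zquot -> Prop) : (forall x, P (zq_pi x)) -> forall a, P a.
Proof. by move=> H a; rewrite -[a]reprK; exact: H. Qed.

Lemma zq_addA : associative zq_add.
Proof.
elim/zq_ind=> x; elim/zq_ind=> y; elim/zq_ind=> z.
by rewrite !zq_addE addrA.
Qed.

Lemma zq_addC : commutative zq_add.
Proof. by elim/zq_ind=> x; elim/zq_ind=> y; rewrite !zq_addE addrC. Qed.

Lemma zq_add0 : left_id (zq_pi 0) zq_add.
Proof. by elim/zq_ind=> x; rewrite zq_addE add0r. Qed.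

Lemma zq_addN : left_inverse (zq_pi 0) zq_opp zq_add.
Proof. by elim/zq_ind=> x; rewrite zq_oppE zq_addE addNr. Qed.

HB.instance Definition _ := GRing.isZmodule.Build zquot zq_addA zq_addC zq_add0 zq_addN.

Lemma zq_pi_additive : zmod_morphism zq_pi.
Proof. by move=> x y; rewrite -zq_addE -zq_oppE. Qed.

End ZmodQuotient.

(** Serves to compute modulo the values of lower-dimensional simplices; the exact kernel allows a
    return from vanishing in the quotient to membership in K. *)
Lemma zmod_quotient (U : zmodType) (K : set U) : K 0 ->
  (forall x y, K x -> K y -> K (x - y)) ->
  exists (Q : zmodType) (pi : {additive U -> Q}), forall x, pi x = 0 <-> K x.
Proof.
move=> K0 KB; exists (zquot K0 KB).
pose pi : {additive U -> zquot K0 KB} := HB.pack (@zq_pi U K K0 KB)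
  (GRing.isZmodMorphism.Build _ _ _ (@zq_pi_additive U K K0 KB)).
exists pi => x; rewrite -[X in K X]subr0; split=> [px|Kx]; last exact/zq_piP.
by apply/(zq_piP K0 KB).
Qed.

(** * Relations between simplices of all dimensions *)

Lemma indUI (T : Type) (A B : set T) x :
  ind A x + ind B x = ind (A `|` B) x + ind (A `&` B) x.
Proof.
rewrite /ind asbool_or asbool_and.
by case: `[< A x >]; case: `[< B x >].
Qed.

Section Chains.
Variables (R : realType) (N : nat).
Local Notation V := 'rV[R]_N.

(* Functionals are applied to the vertex set of a simplex, not to the simplex. *)
Definition elementary m (mu : set V -> R) : Prop :=
  mu set0 = 0 /\
  forall k (s : 'I_k.+1 -> V) i j (t : R) (z : V), (k < m)%N ->
    affinely_independent s -> i != j -> 0 < t < 1 -> z = (1 - t) *: s i + t *: s j ->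
    mu (range s) + mu (range (upd s i z \o lift j)) =
    mu (range (upd s i z)) + mu (range (upd s j z)).

(** Here k counts vertices: the dimension is k - 1, and k = 0 gives the empty set. *)
Definition simplex_set k (X : set V) : Prop :=
  exists s : 'I_k -> V, affinely_independent s /\ X = range s.

Definition is_chain m (C : seq (int * set V)) : Prop :=
  forall p, p \in C -> exists2 k, (k <= m)%N & simplex_set k p.2.

Lemma elementary_leq m m' mu : (m' <= m)%N -> elementary m mu -> elementary m' mu.
Proof.
move=> mm [mu0 H]; split=> // k s i j t z km; apply: H.
exact: leq_trans km mm.
Qed.

Lemma elementary_ind m (x : V) :
  elementary m (fun X => (ind (convex_hull X) x)%:~R).
Proof.
split; first by rewrite convex_hull0 /ind asboolF.
move=> k s i j t z km sI ij t01 hz; rewrite -!intrD; congr (_%:~R).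
rewrite !fhullE (fhull_edgeU ij t01 hz) -(fhull_edgeI sI ij t01 hz).
by rewrite -indUI.
Qed.

Section TopDimension.
Variables (m : nat) (G : zmodType) (nu : set V -> G).
Hypothesis nu_low : forall k X, (k <= m)%N -> simplex_set k X -> nu X = 0.
Hypothesis nuA : simple_additive m.+1 nu.

(** The columns of the cokernel are equations for the span of [s], and one of them fails on E. So
    the hull meets the flat of E only inside a proper hyperplane of it. *)
Lemma avoid_flat k (s : 'I_k -> V) n (E : 'M[R]_(n, 1 + N)) : ~~ (E <= homogm s)%MS ->
  exists w : 'cV[R]_(1 + N), E *m w != 0 /\ forall x, fhull s x -> ev w x = 0.
Proof.
rewrite submxE => Es.
have [j wj] : exists j, E *m col j (cokermx (homogm s)) != 0.
  apply: contrapT => /forallNP H; case/eqP: Es; apply/matrixP => i j.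
  have /negP/negPn/eqP Hj := H j.
  transitivity ((E *m col j (cokermx (homogm s))) i 0); last by rewrite Hj !mxE.
  by rewrite [LHS]mxE [RHS]mxE; apply: eq_bigr => l _; rewrite [col _ _ _ _]mxE.
exists (col j (cokermx (homogm s))); split=> // x [l [_ hx]].
rewrite ev_col; have := homog_comb_sub hx; rewrite submxE => /eqP ->.
by rewrite mxE.
Qed.

(** Within the flat of one simplex with m + 1 vertices, all simplices spanning another flat are
    contained in finitely many hyperplanes. The relation thus holds there almost everywhere among
    those spanning this flat, and [simple_relation] applies. *)
Lemma top_relation (C : seq (int * set V)) : is_chain m.+1 C ->
  (forall x, \sum_(p <- C) p.1 * ind (convex_hull p.2) x = 0) ->
  \sum_(p <- C) nu p.2 *~ p.1 = 0.
Proof.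
move=> Cm C0; rewrite big_tnth.
pose c i := (tnth (in_tuple C) i).1; pose X i := (tnth (in_tuple C) i).2.
have {}Cm i : exists2 k, (k <= m.+1)%N & simplex_set k (X i).
  by apply: Cm; exact: mem_tnth.
have {}C0 x : \sum_i c i * ind (convex_hull (X i)) x = 0.
  have := C0 x; rewrite big_tnth; exact.
pose top i := `[< simplex_set m.+1 (X i) >].
have /choice[s sP] i : exists u : 'I_m.+1 -> V,
    top i -> affinely_independent u /\ X i = range u.
  rewrite /top; case: asboolP => [[u uP]|_]; first by exists u.
  by exists (fun=> 0).
have nu0 i : ~~ top i -> nu (X i) = 0.
  have [k] := Cm i; rewrite leq_eqVlt => /orP[/eqP->|km] Xk.
    by rewrite /top asboolT.
  by move=> _; exact: nu_low Xk.
(* [<<_>>] is a canonical generator of the row space, so equal keys mean equal flats. *)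
apply: (sum_by_key (key := fun i => <<homogm (s i)>>%MS)) => v.
pose good i := top i && (<<homogm (s i)>>%MS == v).
have [[i0 /andP[top0 /eqP key0]]|none] := pselect (exists i, good i); last first.
  apply: big1 => i iv; rewrite [nu _](nu0 i) ?mul0rz //.
  by apply: contra_notN none => ti; exists i; rewrite /good ti iv.
have [s0I X0] := sP _ top0.
have [E [f [g [Ef fE EE fg]]]] := flat_param s0I.
have nu'A : simple_additive m.+1 (fun Y : set 'rV[R]_m => nu (f @` Y)).
  move=> t i j a z tI ij a01 hz; rewrite !image_range.
  have fupd l : f \o upd t l z = upd (f \o t) l (f z).
    by apply/funext => q; rewrite /= /upd; case: eqP.
  rewrite !fupd; apply: nuA => //; first exact/(aind_embed Ef fE).
    exact: a01.
  by rewrite hz (embed_comb2 fE) // subrK.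
pose t i := g \o s i; pose c' i := if good i then c i else 0.
have ft i : good i -> f \o t i = s i.
  move=> /andP[ti /eqP ki]; apply/funext => q /=; apply: fg.
  have : (homog (s i q) <= homogm (s i))%MS.
    by rewrite -(rowK (fun i' => homog (s i i'))) row_sub.
  by rewrite -(genmxE (homogm (s i))) ki -key0 genmxE.
have /choice[w wP] i : exists w : 'cV[R]_(1 + N), ~~ good i ->
    E *m w != 0 /\ forall x, convex_hull (X i) x -> ev w x = 0.
  have [gi|gi] := boolP (good i); first by exists 0.
  (* If its span contained the flat, a simplex with m + 1 vertices would have the same key by
     equality of ranks; one with fewer vertices has too small a rank. *)
  suff [k [u [Xu Eu]]] : exists k (u : 'I_k -> V), X i = range u /\ ~~ (E <= homogm u)%MS.
    by have [w wP] := avoid_flat Eu; exists w => _; rewrite Xu fhullE.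
  have [ti|ti] := boolP (top i).
    have [siI Xi] := sP _ ti; exists m.+1, (s i); split=> //.
    apply: contraNN gi => Es; rewrite /good ti -key0 /=; apply/eqP/genmxP.
    have /eqmxP := EE; move=> /andP[E1 E2].
    have := mxrank_leqif_sup Es; rewrite EE.
    have /eqP -> : row_free (homogm (s i0)) by exact/aind_row_free.
    have /eqP -> : row_free (homogm (s i)) by exact/aind_row_free.
    by case=> _; rewrite eqxx => /esym sE; rewrite -!EE sE Es.
  have [k] := Cm i; rewrite leq_eqVlt => /orP[/eqP->|km] Xk; first by case/asboolP: ti.
  have [u [uI Xu]] := Xk; exists k, u; split=> //.
  apply/negP => /mxrankS; rewrite EE.
  have /eqP -> : row_free (homogm (s i0)) by exact/aind_row_free.
  have /eqP -> : row_free (homogm u) by exact/aind_row_free.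
  by rewrite leqNgt km.
have := simple_relation nu'A (c := c') (s := t)
  (ws := [seq E *m w i | i <- enum 'I_(size C) & ~~ good i]).
move=> H; rewrite -[RHS]H {H}.
- rewrite [LHS]big_mkcond; apply: eq_bigr => i _; rewrite /c'.
  case: ifP => ki; last by rewrite /good ki andbF.
  rewrite /good ki andbT; have [ti|ti] := boolP (top i); last by rewrite [nu _](nu0 i) ?mul0rz.
  by rewrite image_range ft ?/good ?ti ?ki // -(sP _ ti).2.
- move=> i; rewrite /c'; case: ifP => [gi _|]; last by rewrite eqxx.
  apply/(aind_embed Ef fE); rewrite ft //.
  by have [/sP[]] := andP gi.
- by move=> v0 /mapP[i]; rewrite mem_filter => /andP[/wP[Ew _] _] ->.
move=> y hy; rewrite -[RHS](C0 (f y)); apply: eq_bigr => i _; rewrite /c'.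
case: ifP => gi.
  congr (_ * _); apply: ind_eq; rewrite -(fhull_embed Ef fE) ft //.
  by have [/sP[_ ->]] := andP gi; rewrite fhullE.
rewrite mul0r [X in _ * X](_ : _ = 0) ?mulr0 // /ind asboolF // => Xy.
have [Ew wz] := wP i (negbT gi); have := wz _ Xy; rewrite (ev_embed fE) => w0.
suff : ev (E *m w i) y != 0 by rewrite w0 eqxx.
by apply: hy; apply/mapP; exists i; rewrite // mem_filter gi mem_enum.
Qed.

End TopDimension.

(* The induction passes to the universal elementary functional modulo the values
   of simplices with at most m vertices, which is simple on those with m + 1. *)
Theorem chain_relation m (C : seq (int * set V)) : is_chain m C ->
  (forall x, \sum_(p <- C) p.1 * ind (convex_hull p.2) x = 0) ->
  forall mu, elementary m mu -> \sum_(p <- C) mu p.2 *~ p.1 = 0.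
Proof.
elim: m C => [|m IH] C Cm C0 mu mue.
  rewrite big_seq big1 // => p /Cm[k]; rewrite leqn0 => /eqP -> [s [_ ->]].
  rewrite (_ : range s = set0) ?mue.1 ?mul0rz //.
  by apply/seteqP; split=> // x [[]].
(* The universal functional [u] sends X to the evaluation of all elementary functionals at X, so an
   identity between its values holds for all of them at once. *)
pose T := {e : set V -> R | elementary m.+1 e}.
pose u (X : set V) : T -> R := fun e => sval e X.
have sumE (D : seq (int * set V)) e :
    (\sum_(p <- D) u p.2 *~ p.1) e = \sum_(p <- D) sval e p.2 *~ p.1.
  rewrite fct_sumE; apply: eq_bigr => p _.
  by case: p.1 => q; rewrite ?NegzE ?mulrNz -?pmulrn ?opprfctE natmulfctE.
pose K : set (T -> R) := [set h | exists2 D, is_chain m D & h = \sum_(p <- D) u p.2 *~ p.1].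
have K0 : K 0 by exists [::]; rewrite ?big_nil.
have KB x y : K x -> K y -> K (x - y).
  move=> [D1 D1m ->] [D2 D2m ->].
  exists (D1 ++ [seq (- p.1, p.2) | p <- D2]).
    by move=> p; rewrite mem_cat => /orP[/D1m//|/mapP[q /D2m ? ->]].
  rewrite big_cat big_map /= -sumrN; congr (_ + _).
  by apply: eq_bigr => p _; rewrite mulrNz.
have [Q [pi piK]] := zmod_quotient K0 KB.
have low k X : (k <= m)%N -> simplex_set k X -> pi (u X) = 0.
  move=> km Xk; apply/piK; exists [:: (1, X)]; last by rewrite big_seq1 mulr1z.
  by move=> p; rewrite inE => /eqP ->; exists k.
have simp : simple_additive m.+1 (fun X => pi (u X)).
  move=> s i j t z sI ij t01 hz; rewrite -raddfD.
  have <- : u (range s) + u (range (upd s i z \o lift j)) =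
      u (range (upd s i z)) + u (range (upd s j z)).
    by apply/funext => e; exact: ((svalP e).2 m s i j t z (ltnSn m) sI ij t01 hz).
  rewrite raddfD /= (low m (range (upd s i z \o lift j))) ?addr0 //.
  exists (upd s i z \o lift j); split=> //; apply: aind_comp; first exact: lift_inj.
  by have [] := aind_edge sI ij t01 hz.
have := top_relation low simp Cm C0.
under eq_bigr do rewrite -raddfMz.
(* Vanishing in the quotient yields a combination D of simplices with at most m vertices on which
   every elementary functional has the same value as on C. *)
rewrite -raddf_sum => /piK[D Dm CD].
have key e : elementary m.+1 e -> \sum_(p <- C) e p.2 *~ p.1 = \sum_(p <- D) e p.2 *~ p.1.
  by move=> ee; have := congr1 (fun h => h (exist _ e ee)) CD; rewrite !sumE.
rewrite key //; apply: IH => //; last exact: elementary_leq mue.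
(* The indicator relation passes from C to D because evaluating indicators at x is itself
   elementary. *)
move=> x; apply: (@intr_inj R); rewrite rmorph_sum /= mulr0z.
transitivity (\sum_(p <- D) (ind (convex_hull p.2) x)%:~R *~ p.1 : R).
  by apply: eq_bigr => p _; rewrite intrM mulrC mulrzr.
rewrite -(key _ (elementary_ind _ x)) -[RHS](@rmorph0 _ _ (intmul 1)) -(C0 x) rmorph_sum.
by apply: eq_bigr => p _; rewrite /= intrM mulrC mulrzr.
Qed.

End Chains.

(** * Induction on polytopes *)

Section PolytopeInduction.
Variables (R : realType) (N : nat).
Local Notation V := 'rV[R]_N.
Implicit Types (x : V) (w : 'cV[R]_(1 + N)) (ws : seq 'cV[R]_(1 + N)).

Definition polytope (A : set V) : Prop :=
  exists k (p : 'I_k -> V), A = convex_hull (range p).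

Definition halfspaces ws : set V := [set x | forall w, w \in ws -> 0 <= ev w x].

Lemma halfspaces_cons w ws : halfspaces (w :: ws) = halfspaces [:: w] `&` halfspaces ws.
Proof.
apply/seteqP; split=> [x H|x [Hw H] w'].
  by split=> w' w'in; apply: H; move: w'in; rewrite !inE => ->; rewrite ?orbT.
by rewrite inE => /orP[/eqP ->|]; [apply: Hw; rewrite inE|exact: H].
Qed.

Lemma halfspace1 w : halfspaces [:: w] = [set x | 0 <= ev w x].
Proof.
apply/seteqP; split=> x; first by apply; rewrite inE.
by move=> H w'; rewrite inE => /eqP ->.
Qed.

Lemma convex_fhull k (s : 'I_k -> V) : @convex_set R V (fhull s).
Proof. by rewrite -fhullE; exact: convex_convex_hull. Qed.

Lemma convex_halfspaces ws : @convex_set R V (halfspaces ws).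
Proof.
move=> x y t /set_mem Hx /set_mem Hy; apply/mem_set => w ww.
rewrite [_ <| _ |> _](_ : _ = t%:num *: (x : V) + (1 - t%:num) *: (y : V)) //.
rewrite ev_comb2; last by rewrite addrC subrK.
by rewrite addr_ge0 // mulr_ge0 ?subr_ge0 //; [exact: Hx|exact: Hy].
Qed.

Lemma convex_setI (A B : set V) : @convex_set R V A -> @convex_set R V B ->
  @convex_set R V (A `&` B).
Proof.
move=> cA cB x y t /set_mem[Ax Bx] /set_mem[Ay By]; apply/mem_set; split.
  by apply/set_mem/cA; exact/mem_set.
by apply/set_mem/cB; exact/mem_set.
Qed.

Lemma polytope_fhull k (s : 'I_k -> V) : polytope (fhull s).
Proof. by exists k, s; rewrite fhullE. Qed.

Lemma polytopeU (A B : set V) : polytope A -> polytope B ->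
  @convex_set R V (A `|` B) -> polytope (A `|` B).
Proof.
move=> [k [p ->]] [l [q ->]] cAB.
pose r (i : 'I_(k + l)) := match fintype.split i with inl a => p a | inr b => q b end.
have pr a : r (lshift l a) = p a by rewrite /r (unsplitK (inl a)).
have qr b : r (rshift k b) = q b by rewrite /r (unsplitK (inr b)).
exists (k + l)%N, r; apply/seteqP; split.
  rewrite subUset !fhullE; split; apply: fhull_range => _ [i _ <-].
    by exists (lshift l i).
  by exists (rshift k i).
apply: smallest_sub => // _ [i _ <-]; rewrite /r; case: (fintype.split i) => j.
  by left; apply: sub_gen_smallest; exists j.
by right; apply: sub_gen_smallest; exists j.
Qed.

(** Induction on the number of vertices off the hyperplane w = 0. An edge joining a positive to a
    negative vertex is cut at its zero, which leaves fewer such vertices in both pieces and in their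
    common face. *)
Lemma halfspace_ind w (Phi : forall k, ('I_k -> V) -> Prop) :
  (forall k (s : 'I_k -> V), (forall i, 0 <= ev w (s i)) -> Phi k s) ->
  (forall k (s : 'I_k.+1 -> V) j, ev w (s j) < 0 -> (forall i, ev w (s i) <= 0) ->
     Phi k (s \o lift j) -> Phi k.+1 s) ->
  (forall k (s : 'I_k.+1 -> V) i j (t : R) (z : V), i != j -> 0 < t < 1 ->
     z = (1 - t) *: s i + t *: s j -> Phi k.+1 (upd s i z) -> Phi k.+1 (upd s j z) ->
     Phi k (upd s i z \o lift j) -> Phi k.+1 s) ->
  forall k s, Phi k s.
Proof.
move=> Hpos Hneg Hcut k s.
have [m] := ubnP #|[pred i | ev w (s i) != 0]|; elim: m k s => // m IH k s sm.
have [pos|] := pselect (forall i, 0 <= ev w (s i)); first exact: Hpos.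
move=> /existsNP[j /negP]; rewrite -ltNge => wj.
case: k s j wj sm => [|k] s j wj sm; first by case: j wj.
have drop (u : 'I_k.+1 -> V) : ev w (u j) != 0 ->
    (#|[pred i | ev w ((u \o lift j) i) != 0%R]| < #|[pred i | ev w (u i) != 0%R]|)%N.
  move=> uj; have <- := card_image (@lift_inj _ j) [pred i | ev w ((u \o lift j) i) != 0].
  apply: proper_card.
  apply/properP; split.
    by apply/fintype.subsetP => y /fintype.imageP[i iw ->].
  exists j; first by rewrite inE.
  apply/negP => /fintype.imageP[i iw /eqP]; by rewrite (negPf (neq_lift _ _)).
have [neg|] := pselect (forall i, ev w (s i) <= 0).
  apply: (Hneg _ _ j) => //; apply: IH; apply: leq_trans (drop _ _) _ => //.
  by rewrite lt_eqF.
move=> /existsNP[i /negP]; rewrite -ltNge => wi.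
have ij : i != j by apply: contraTneq wi => ->; rewrite -leNgt ltW.
pose D := ev w (s i) - ev w (s j).
have D0 : 0 < D by rewrite subr_gt0 (lt_trans wj).
pose t := ev w (s i) / D; pose z := (1 - t) *: s i + t *: s j.
have t01 : 0 < t < 1 by rewrite divr_gt0 //= ltr_pdivrMr // mul1r /D ltrDl oppr_gt0.
have wz : ev w z = 0.
  by rewrite ev_comb2 ?subrK // /t /D; field; rewrite gt_eqF.
have lt_upd i' : ev w (s i') != 0 ->
    (#|[pred l | ev w (upd s i' z l) != 0%R]| < #|[pred l | ev w (s l) != 0%R]|)%N.
  move=> wi'; apply: proper_card; apply/properP; split.
    apply/fintype.subsetP => l; rewrite !inE /upd.
    by case: (l == i') => //; rewrite wz eqxx.
  by exists i'; rewrite ?inE // upd_same wz eqxx.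
have win : ev w (s i) != 0 by rewrite gt_eqF.
have wjn : ev w (s j) != 0 by rewrite lt_eqF.
apply: (Hcut _ _ i j t z) => //; apply: IH.
- exact: leq_trans (lt_upd _ _) _.
- exact: leq_trans (lt_upd _ _) _.
apply: leq_trans (drop _ _) _; first by rewrite upd_other // eq_sym.
by apply: ltnW; exact: leq_trans (lt_upd _ _) _.
Qed.

Lemma fhull_ev_ge0 w k (s : 'I_k -> V) : (forall i, 0 <= ev w (s i)) ->
  fhull s `<=` [set x | 0 <= ev w x].
Proof.
move=> H x [l [l0 /(ev_comb w) /= ->]].
by apply: sumr_ge0 => i _; rewrite mulr_ge0.
Qed.

(** Without positive vertices, a point of the halfspace gives weight 0 to every strictly negative
    vertex. *)
Lemma fhull_drop_neg w k (s : 'I_k.+1 -> V) j : ev w (s j) < 0 ->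
  (forall i, ev w (s i) <= 0) ->
  fhull s `&` [set x | 0 <= ev w x] = fhull (s \o lift j) `&` [set x | 0 <= ev w x].
Proof.
move=> wj wn; apply/seteqP; split=> [x [[l [l0 hx]] wx]|]; last first.
  by apply: setSI; apply: fhull_range; exact: range_comp_sub.
split=> //; exists (l \o lift j); split=> [i|]; first exact: l0.
suff lj : l j = 0 by rewrite hx (bigD1_ord j) //= lj scale0r add0r.
move: wx; rewrite /= (ev_comb w hx) (bigD1_ord j) //= => wx.
apply/eqP; rewrite eq_le l0 andbT leNgt; apply/negP => lj; move: wx; apply/negP.
rewrite -ltNge -[ltRHS]addr0 ltr_leD // ?pmulr_rlt0 //.
by apply: sumr_le0 => i _; rewrite mulr_ge0_le0.
Qed.

Lemma polytope_halfspaces A ws : polytope A -> polytope (A `&` halfspaces ws).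
Proof.
elim: ws A => [|w ws IH] A pA.
  rewrite (_ : _ `&` _ = A) // (_ : halfspaces _ = setT) ?setIT //.
  by apply/seteqP; split.
rewrite halfspaces_cons setIA; apply: IH.
move: pA => [k [s ->]]; rewrite fhullE halfspace1.
elim/(halfspace_ind (w := w)): k / s 
  => [k s pos|k s j wj wn|k s i j t z ij t01 hz pi pj _].
- rewrite (_ : _ `&` _ = fhull s); first exact: polytope_fhull.
  by apply/setIidl; exact: fhull_ev_ge0.
- by rewrite (fhull_drop_neg wj wn).
have E : fhull s `&` [set x | 0 <= ev w x] =
    (fhull (upd s i z) `&` [set x | 0 <= ev w x]) `|`
    (fhull (upd s j z) `&` [set x | 0 <= ev w x]).
  by rewrite -setIUl -(fhull_edgeU ij t01 hz).
(* The union of the two polytopes is a polytope because it is convex, being the hull intersected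
   with a halfspace. *)
rewrite E; apply: polytopeU => //; rewrite -E; apply: convex_setI.
  exact: convex_fhull.
by rewrite -halfspace1; exact: convex_halfspaces.
Qed.

(** The barycentric coordinates are nonnegative, and each equation of the affine hull is written as
    two opposite inequalities. *)
Lemma simplex_halfspaces k (s : 'I_k -> V) : affinely_independent s ->
  exists ws, fhull s = halfspaces ws.
Proof.
move=> sI; pose M := homogm s.
pose cs := [seq col j (cokermx M) | j <- enum 'I_(1 + N)].
exists ([seq bary s j | j <- enum 'I_k] ++ cs ++ [seq - w | w <- cs]).
apply/seteqP; split=> [x xs w|x H].
  have sx : (homog x <= M)%MS by case: xs => l [_ /homog_comb_sub].
  have c0 j : ev (col j (cokermx M)) x = 0.
    by rewrite ev_col; move: sx; rewrite submxE => /eqP ->; rewrite mxE.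
  rewrite !mem_cat => /or3P[/mapP[j _ ->]|/mapP[j _ ->]|/mapP[_ /mapP[j _ ->] ->]].
  - by move: j; apply/(fhull_bary sI sx).
  - by rewrite c0.
  - by rewrite evN c0 oppr0.
have sx : (homog x <= M)%MS.
  rewrite submxE; apply/eqP/rowP => j; rewrite [RHS]mxE -ev_col.
  have jc : col j (cokermx M) \in cs by apply: map_f; rewrite mem_enum.
  apply/eqP; rewrite eq_le -oppr_ge0 -evN.
  by rewrite !H // !mem_cat ?jc ?map_f ?orbT.
apply/(fhull_bary sI sx) => j; apply: H; rewrite mem_cat map_f //.
by rewrite mem_enum.
Qed.

(** An affine dependence c has a positive coefficient, as its coefficients sum to 0. Subtracting the
    multiple with the least ratio l_i / c_i over c_i > 0 kills one weight and keeps the others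
    nonnegative. *)
Lemma caratheodory_drop k (p : 'I_k.+1 -> V) x : ~ affinely_independent p ->
  fhull p x -> exists i, fhull (p \o lift i) x.
Proof.
move=> dep [l [l0 hx]].
have [c [c0 [i0 ci0]]] : exists c : 'I_k.+1 -> R,
    \sum_i c i *: homog (p i) = 0 /\ exists i, 0 < c i.
  apply: contrapT => none; apply: dep; apply/aindP => c c0 i.
  have csum : \sum_i c i = 0.
    move: c0; rewrite homog_sum -row_mx0 => /eq_row_mx[/matrixP /(_ 0 0)].
    by rewrite !mxE.
  have cn j : c j <= 0.
    by rewrite leNgt; apply/negP => cj; apply: none; exists c; split=> //; exists j.
  apply/eqP; rewrite -oppr_eq0; apply/eqP.
  apply: (@psumr_eq0P R _ predT (fun i => - c i)) => // [j _|].
    by rewrite oppr_ge0.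
  by rewrite sumrN csum oppr0.
case: (@Order.TotalTheory.arg_minP _ R _ i0 (fun i => 0 < c i) (fun i => l i / c i) ci0).
move=> m cm mmin; exists m.
pose l' i := l i - l m / c m * c i.
have l'0 i : 0 <= l' i.
  rewrite /l' subr_ge0; have [ci|ci] := ltP 0 (c i).
    by rewrite -ler_pdivlMr //; exact: mmin.
  by apply: le_trans (l0 i); rewrite mulr_ge0_le0 // divr_ge0 // ltW.
exists (l' \o lift m); split=> [i|]; first exact: l'0.
have : homog x = \sum_i l' i *: homog (p i).
  under eq_bigr do rewrite scalerBl -scalerA.
  by rewrite sumrB -scaler_sumr c0 scaler0 subr0.
by rewrite (bigD1_ord m) //= /l' divfK ?gt_eqF // subrr scale0r add0r.
Qed.

(** The covering simplices are recorded by their bounding functionals, along which the polytope is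
    cut afterwards. *)
Lemma simplex_cover k (p : 'I_k -> V) : exists Ts : seq (seq 'cV[R]_(1 + N)),
  (forall ws, ws \in Ts -> exists m (s : 'I_m -> V),
     [/\ affinely_independent s, fhull s `<=` fhull p & fhull s = halfspaces ws]) /\
  (forall x, fhull p x -> exists2 ws, ws \in Ts & halfspaces ws x).
Proof.
elim: k p => [|k IH] p.
  have pI : affinely_independent p by move=> c _ _ [].
  have [ws pw] := simplex_halfspaces pI; exists [:: ws]; split=> [_ /[1!inE] /eqP ->|x].
    by exists 0%N, p; split; [|exact: subset_refl|].
  by rewrite pw => wx; exists ws; rewrite ?inE.
have [pI|pI] := pselect (affinely_independent p).
  have [ws pw] := simplex_halfspaces pI; exists [:: ws]; split=> [_ /[1!inE] /eqP ->|x].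
    by exists k.+1, p; split; [|exact: subset_refl|].
  by rewrite pw => wx; exists ws; rewrite ?inE.
have /choice[T TP] i := IH (p \o lift i).
exists (flatten [seq T i | i <- enum 'I_k.+1]); split=> [ws|x].
  move=> /flatten_mapP[i _ /(TP i).1[m [s [sI sp sw]]]]; exists m, s; split=> //.
  by apply: subset_trans sp _; apply: fhull_range; exact: range_comp_sub.
move=> /(caratheodory_drop pI)[i /(TP i).2[ws wT wx]]; exists ws => //.
by apply/flatten_mapP; exists i; rewrite // mem_enum.
Qed.

Section Induction.
Variables (Q : set V -> Prop) (P : set V).
Hypotheses (Q_simplex : forall k (s : 'I_k -> V), affinely_independent s ->
    fhull s `<=` P -> Q (fhull s))
  (Q_glue : forall A B, polytope A -> polytope B -> polytope (A `|` B) ->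
    polytope (A `&` B) -> A `|` B `<=` P -> Q A -> Q B -> Q (A `&` B) -> Q (A `|` B)).

(** One halfspace at a time: it contains the simplex, or a negative vertex is dropped, or the two
    pieces of a cut edge are glued along their common face. *)
Lemma Q_simplex_halfspaces ws k (s : 'I_k -> V) : affinely_independent s ->
  fhull s `<=` P -> Q (fhull s `&` halfspaces ws).
Proof.
elim: ws k s => [|w ws IH] k s.
  rewrite (_ : fhull s `&` _ = fhull s); first exact: Q_simplex.
  by rewrite (_ : halfspaces _ = setT) ?setIT //; apply/seteqP; split.
elim/(halfspace_ind (w := w)): k / s 
  => [k s pos|k s j wj wn H|k s i j t z ij t01 hz Hi Hj Hij] sI sP.
- rewrite halfspaces_cons halfspace1 setIA (_ : fhull s `&` _ = fhull s); first exact: IH.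
  by apply/setIidl; exact: fhull_ev_ge0.
- rewrite halfspaces_cons halfspace1 setIA (fhull_drop_neg wj wn) -setIA -halfspace1.
  rewrite -halfspaces_cons; apply: H.
    by apply: aind_comp sI; exact: lift_inj.
  by apply: subset_trans sP; apply: fhull_range; exact: range_comp_sub.
have [iI jI] := aind_edge sI ij t01 hz.
have [iP jP] : fhull (upd s i z) `<=` P /\ fhull (upd s j z) `<=` P.
  by move: sP; rewrite (fhull_edgeU ij t01 hz) subUset.
have UE : fhull s `&` halfspaces (w :: ws) =
    (fhull (upd s i z) `&` halfspaces (w :: ws)) `|`
    (fhull (upd s j z) `&` halfspaces (w :: ws)).
  by rewrite -setIUl -(fhull_edgeU ij t01 hz).
have IE : fhull (upd s i z \o lift j) `&` halfspaces (w :: ws) =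
    (fhull (upd s i z) `&` halfspaces (w :: ws)) `&`
    (fhull (upd s j z) `&` halfspaces (w :: ws)).
  by rewrite setIACA setIid -(fhull_edgeI sI ij t01 hz).
have pol m (u : 'I_m -> V) : polytope (fhull u `&` halfspaces (w :: ws)).
  by apply: polytope_halfspaces; exact: polytope_fhull.
rewrite UE; apply: Q_glue; rewrite -?UE -?IE //.
- by move=> x [/sP].
- exact: Hi.
- exact: Hj.
apply: Hij; first by apply: aind_comp iI; exact: lift_inj.
by apply: subset_trans iP; apply: fhull_range; exact: range_comp_sub.
Qed.

(** All sets met in the induction lie in P, so a bound on the dimension of P is inherited by
    them. *)
Theorem polytope_induction : polytope P -> Q P.
Proof.
move=> [k [p Pp]]; rewrite fhullE in Pp.
have [Ts [Tsimp Tcov]] := simplex_cover p.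
(* The list l holds the functionals still to be cut along; every other bounding functional has a
   constant sign on the piece C. *)
have main (l hs : seq 'cV[R]_(1 + N)) : let C := P `&` halfspaces hs in
    (forall w, w \in flatten Ts -> w \in l \/
       (forall x, C x -> 0 <= ev w x) \/ (forall x, C x -> ev w x <= 0)) -> Q C.
  elim: l hs => [|w l IH] hs C def.
    have [m [q Cq]] : polytope C.
      by rewrite /C Pp; apply: polytope_halfspaces; exact: polytope_fhull.
    rewrite fhullE in Cq.
    case: m q Cq => [|m] q Cq.
      rewrite Cq; apply: Q_simplex; first by move=> c _ _ [].
      by rewrite -Cq; apply: subIsetl.
    (* The mean of the vertices of C lies in some covering simplex. A bounding functional of that
       simplex which is nonpositive on C but nonnegative at b vanishes at all vertices, so the
       simplex contains C. *)
    pose b := \sum_(i < m.+1) m.+1%:R^-1 *: q i.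
    have hb : homog b = \sum_i m.+1%:R^-1 *: homog (q i).
      apply/homog_combP; split=> //.
      by rewrite sumr_const card_ord -[_ *+ _]mulr_natl divff // pnatr_eq0.
    have Cb : C b.
      by rewrite Cq; exists (fun=> m.+1%:R^-1); split=> // i; rewrite invr_ge0.
    have [|ws wT wb] := Tcov b; first by rewrite -Pp; case: Cb.
    have [m' [s [sI sp sw]]] := Tsimp _ wT.
    have Cs : C `<=` fhull s.
      rewrite sw => x Cx w ww.
      have wf : w \in flatten Ts by apply/flattenP; exists ws.
      have [//|[pos|neg]] := def w wf; first exact: pos.
      have q0 i : ev w (q i) = 0.
        have Cqi j : C (q j) by rewrite Cq; exact: mem_fhull.
        have := wb w ww; rewrite (ev_comb w hb) -mulr_sumr pmulr_rge0 ?invr_gt0 ?ltr0n //.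
        move=> sum0; apply/eqP; rewrite -oppr_eq0; apply/eqP.
        apply: (@psumr_eq0P R _ predT (fun i => - ev w (q i))) => // [j _|].
          by rewrite oppr_ge0 neg.
        apply/eqP; rewrite sumrN oppr_eq0 eq_le sum0 andbT.
        by apply: sumr_le0 => j _; exact: neg.
      move: Cx; rewrite Cq => -[c [_ /(ev_comb w) ->]].
      by rewrite big1 // => i _; rewrite q0 mulr0.
    rewrite (_ : C = fhull s `&` halfspaces hs); last first.
      apply/seteqP; split=> x; first by move=> Cx; split; [exact: Cs|case: Cx].
      by move=> [/sp xs xh]; split; rewrite ?Pp.
    by apply: Q_simplex_halfspaces => //; rewrite Pp.
  have sub hs' : halfspaces hs' `<=` halfspaces hs -> P `&` halfspaces hs' `<=` C.
    by move=> H x [xP /H].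
  have consS w' hs' : halfspaces (w' :: hs') `<=` halfspaces hs'.
    by rewrite halfspaces_cons; exact: subIsetr.
  have consw w' hs' x : halfspaces (w' :: hs') x -> 0 <= ev w' x.
    by apply; rewrite inE eqxx.
  have stepQ hs' : halfspaces hs' `<=` halfspaces hs ->
      (forall x, halfspaces hs' x -> 0 <= ev w x) \/
      (forall x, halfspaces hs' x -> ev w x <= 0) -> Q (P `&` halfspaces hs').
    move=> sh wd; apply: IH => w' /def; rewrite inE => -[/orP[/eqP ->|->]|]; [|by left|].
      by right; case: wd => wd; [left|right] => x [_ /wd].
    by move=> [H|H]; right; [left|right] => x /(sub _ sh) /H.
  have CU : C = (P `&` halfspaces (w :: hs)) `|` (P `&` halfspaces (- w :: hs)).
    apply/seteqP; split; last by rewrite subUset; split; apply: sub; exact: consS.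
    move=> x [xP xh]; have [wx|/ltW wx] := leP 0 (ev w x); [left|right]; split=> //.
      by move=> w'; rewrite inE => /orP[/eqP ->//|]; exact: xh.
    by move=> w'; rewrite inE => /orP[/eqP ->|]; [rewrite evN oppr_ge0|exact: xh].
  have CI : P `&` halfspaces (w :: - w :: hs) =
      (P `&` halfspaces (w :: hs)) `&` (P `&` halfspaces (- w :: hs)).
    rewrite setIACA setIid; congr (_ `&` _); rewrite (halfspaces_cons w (- w :: hs)).
    rewrite (halfspaces_cons w hs) -setIA; congr (_ `&` _).
    by rewrite setIC; apply/esym/setIidl; exact: consS.
  have pol hs' : polytope (P `&` halfspaces hs').
    by rewrite Pp; apply: polytope_halfspaces; exact: polytope_fhull.
  rewrite CU; apply: Q_glue => //; rewrite -?CU -?CI //.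
  - exact: pol.
  - exact: subIsetl.
  - by apply: stepQ; [exact: consS|left=> x /consw].
  - apply: stepQ; [exact: consS|right=> x /consw]; by rewrite evN oppr_ge0.
  - apply: stepQ; last by left=> x /consw.
    by apply: subset_trans (consS _ _); exact: consS.
rewrite (_ : P = P `&` halfspaces [::]).
  by apply: (main (flatten Ts)) => w ww; left.
by rewrite (_ : halfspaces _ = setT) ?setIT //; apply/seteqP; split.
Qed.

End Induction.

End PolytopeInduction.

(** * Extension of valuations *)

Section Dimension.
Variables (R : realType) (N : nat).
Local Notation V := 'rV[R]_N.

Definition edges k (p : 'I_k.+1 -> V) : k.-tuple V :=
  [tuple p (lift ord0 i) - p ord0 | i < k].

Lemma edges_mem k (p : 'I_k.+1 -> V) i : p i - p ord0 \in <<edges p>>%VS.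
Proof.
case: (unliftP ord0 i) => [j|] ->; last by rewrite subrr mem0v.
by apply: memv_span; apply/tnthP; exists j; rewrite tnth_mktuple.
Qed.

Lemma edges_combE k (p : 'I_k.+1 -> V) (c : 'I_k -> R) :
  \sum_i c i *: (edges p)`_i = \sum_i c i *: p (lift ord0 i) - (\sum_i c i) *: p ord0.
Proof.
rewrite scaler_suml -sumrB; apply: eq_bigr => i _.
by rewrite -tnth_nth tnth_mktuple scalerBr.
Qed.

Lemma affine_hull_fhull k (p : 'I_k.+1 -> V) :
  affine_hull (fhull p) = [set p ord0 + w | w in [set` <<edges p>>%VS]].
Proof.
have fullW x : fhull p x -> x - p ord0 \in <<edges p>>%VS.
  move=> [l [_ /homog_combP[l1 ->]]].
  rewrite -[p ord0]scale1r -l1 scaler_suml -sumrB; apply: memv_suml => i _.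
  by rewrite -scalerBr memvZ // edges_mem.
apply/seteqP; split=> [x [m [q [c [qA c1 ->]]]]|_ [w wW <-]].
  exists (\sum_i c i *: q i - p ord0); last by rewrite addrC subrK.
  suff : \sum_i c i *: q i - p ord0 \in <<edges p>>%VS by [].
  rewrite -[p ord0]scale1r -c1 scaler_suml -sumrB; apply: memv_suml => i _.
  by rewrite -scalerBr; apply: memvZ; exact: fullW.
move: wW => /coord_span; set c := fun i => coord (edges p) i w => hw.
(* The base vertex takes the weight that makes the sum 1. *)
exists k.+1, p, (fun i => if unlift ord0 i is Some j then c j else 1 - \sum_j c j).
split=> [i||].
- exact: mem_fhull.
- rewrite big_ord_recl unlift_none [X in _ + X](eq_bigr c) ?subrK // => j _.
  by rewrite liftK.
rewrite big_ord_recl unlift_none.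
rewrite [X in _ = _ + X](eq_bigr (fun j => c j *: p (lift ord0 j))) => [|j _]; last first.
  by rewrite liftK.
by rewrite hw edges_combE scalerBl scale1r -addrA [- _ + _]addrC.
Qed.

Lemma has_dim_fhull k (p : 'I_k.+1 -> V) : has_dim (fhull p) (\dim <<edges p>>).
Proof. by exists (p ord0), <<edges p>>%VS; rewrite affine_hull_fhull. Qed.

Lemma sub_affine_hull (A : set V) : A `<=` affine_hull A.
Proof.
move=> x Ax; exists 1%N, (fun=> x), (fun=> 1); split=> //.
  by rewrite big_ord1.
by rewrite big_ord1 scale1r.
Qed.

Lemma dim_edges k (p : 'I_k.+1 -> V) (A : set V) n : fhull p `<=` A ->
  dim_le A n -> (\dim <<edges p>> <= n)%N.
Proof.
move=> pA [A0|[d dn [x [W [Wd AW]]]]].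
  by have := pA _ (mem_fhull p ord0); rewrite A0.
apply: leq_trans dn; rewrite -Wd; apply/dimvS/span_subvP => v /tnthP[i ->].
rewrite tnth_mktuple.
have inW j : exists2 w, w \in W & p j = x + w.
  have : affine_hull A (p j) by apply/sub_affine_hull/pA/mem_fhull.
  by rewrite AW => -[w wW <-]; exists w.
have [w1 w1W ->] := inW (lift ord0 i); have [w0 w0W ->] := inW ord0.
by rewrite opprD addrACA subrr add0r memvB.
Qed.

Lemma dim_le_polytope (A B : set V) n : polytope A -> A `<=` B -> dim_le B n ->
  dim_le A n.
Proof.
move=> [[|k] [p ->]] AB Bn.
  left; rewrite (_ : range p = set0) ?convex_hull0 //.
  by apply/seteqP; split=> // x [[]].
right; rewrite fhullE in AB *; exists (\dim <<edges p>>); last exact: has_dim_fhull.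
exact: dim_edges AB Bn.
Qed.

Lemma aind_free k (s : 'I_k.+1 -> V) : affinely_independent s -> free (edges s).
Proof.
move=> sI; apply/freeP => c c0 i.
have := sI (fun j => if unlift ord0 j is Some j' then c j' else - \sum_l c l).
move=> /(_ _ _ (lift ord0 i)); rewrite liftK; apply.
  rewrite big_ord_recl unlift_none [X in _ + X](eq_bigr c) ?addNr // => j _.
  by rewrite liftK.
rewrite big_ord_recl unlift_none.
rewrite [X in _ + X](eq_bigr (fun j => c j *: s (lift ord0 j))) => [|j _]; last first.
  by rewrite liftK.
by rewrite scaleNr addrC -edges_combE.
Qed.

Lemma aind_card k (s : 'I_k -> V) (A : set V) n : affinely_independent s ->
  fhull s `<=` A -> dim_le A n -> (k <= n.+1)%N.
Proof.
case: k s => // k s /aind_free; rewrite /free size_tuple => /eqP sk sA An.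
by rewrite ltnS -sk; exact: dim_edges sA An.
Qed.

Lemma fhull_simplices k (s : 'I_k -> V) n : affinely_independent s ->
  (k <= n.+1)%N -> simplices R N n (fhull s).
Proof.
move=> sI kn; split; first by exists k, s; rewrite fhullE.
case: k s sI kn => [|k] s sI kn.
  left; rewrite -fhullE (_ : range s = set0) ?convex_hull0 //.
  by apply/seteqP; split=> // x [[]].
right; exists (\dim <<edges s>>); last exact: has_dim_fhull.
by rewrite (leq_trans (dim_span _)) // size_tuple.
Qed.

End Dimension.

Section Extension.
Variables (T : Type) (R : zmodType) (C : set (set T)).

(** Extension by 0 to all sets, so that equal sets can be rewritten without transporting membership
    proofs. *)
Definition extend0 (f : C -> R) (A : set T) : R :=
  if pselect (A \in C) is left h then f (SigSub h) else 0.

Lemma extend0E (f : C -> R) (S : C) : extend0 f (val S) = f S.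
Proof.
rewrite /extend0; case: pselect => [h|]; last by case; exact: valP.
by congr f; exact: val_inj.
Qed.

Lemma extend0_mem (f : C -> R) A (h : A \in C) : extend0 f A = f (SigSub h).
Proof. by rewrite -extend0E. Qed.

End Extension.

Section ValuationSets.
Variables (R : realType) (N : nat) (C : set (set 'rV[R]_N)) (f : C -> R).

Lemma valuation_extend0 : valuation f ->
  extend0 f set0 = 0 /\ forall A B, C A -> C B -> C (A `|` B) -> C (A `&` B) ->
    extend0 f A + extend0 f B = extend0 f (A `|` B) + extend0 f (A `&` B).
Proof.
move=> [f0 fU]; split=> [|A B /mem_set CA /mem_set CB /mem_set CU /mem_set CI].
  by rewrite /extend0; case: pselect.
by rewrite !extend0_mem; exact: (fU (SigSub CA) (SigSub CB)).
Qed.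

End ValuationSets.

(** * Integral combinations of simplices and their values *)

Section ChainValues.
Variables (R : realType) (N : nat).
Local Notation V := 'rV[R]_N.
Implicit Type C : seq (int * set V).

Definition chain_ind C (x : V) : int := \sum_(p <- C) p.1 * ind (convex_hull p.2) x.
Definition chain_val (m : set V -> R) C : R := \sum_(p <- C) m p.2 *~ p.1.
Definition chain_opp C := [seq (- p.1, p.2) | p <- C].

Lemma chain_ind_cat C D x : chain_ind (C ++ D) x = chain_ind C x + chain_ind D x.
Proof. exact: big_cat. Qed.

Lemma chain_ind_opp C x : chain_ind (chain_opp C) x = - chain_ind C x.
Proof.
by rewrite /chain_ind big_map -sumrN; apply: eq_bigr => p _; rewrite mulNr.
Qed.

Lemma chain_val_cat m C D : chain_val m (C ++ D) = chain_val m C + chain_val m D.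
Proof. exact: big_cat. Qed.

Lemma chain_val_opp m C : chain_val m (chain_opp C) = - chain_val m C.
Proof.
by rewrite /chain_val big_map -sumrN; apply: eq_bigr => p _; rewrite mulrNz.
Qed.

Lemma is_chain_cat k C D : is_chain k C -> is_chain k D -> is_chain k (C ++ D).
Proof. by move=> HC HD p; rewrite mem_cat => /orP[/HC|/HD]. Qed.

Lemma is_chain_opp k C : is_chain k C -> is_chain k (chain_opp C).
Proof. by move=> HC p /mapP[q /HC ? ->]. Qed.

(** The value depends on the indicator only: [chain_relation] is applied to the difference of C and
    D. *)
Lemma chain_val_unique k m C D : elementary k m -> is_chain k C -> is_chain k D ->
  chain_ind C =1 chain_ind D -> chain_val m C = chain_val m D.
Proof.
move=> mk Ck Dk CD; apply/eqP; rewrite -subr_eq0 -chain_val_opp -chain_val_cat.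
apply/eqP; apply: (chain_relation (m := k)) => //.
  exact: is_chain_cat (is_chain_opp Dk).
by move=> x; rewrite -/(chain_ind _ x) chain_ind_cat chain_ind_opp CD subrr.
Qed.

Lemma is_chain1 k m (s : 'I_m -> V) : (m <= k)%N -> affinely_independent s ->
  is_chain k [:: (1, range s)].
Proof. by move=> mk sI p; rewrite inE => /eqP ->; exists m => //; exists s. Qed.

Lemma chain_ind1 m (s : 'I_m -> V) x : chain_ind [:: (1, range s)] x = ind (fhull s) x.
Proof. by rewrite /chain_ind big_seq1 mul1r fhullE. Qed.

(** Inclusion-exclusion along [polytope_induction]; the dimension of P bounds the number of vertices
    of each simplex by n + 1. *)
Lemma polytope_chain n (P : set V) : polytopes R N n P ->
  exists C, is_chain n.+1 C /\ chain_ind C =1 ind P.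
Proof.
move=> [polP dimP].
apply: (polytope_induction (Q := fun A => exists C, is_chain n.+1 C /\ chain_ind C =1 ind A))
  polP => [k s sI sP|A B _ _ _ _ _].
  exists [:: (1, range s)]; split; last exact: chain_ind1.
  by apply: is_chain1 => //; exact: aind_card sI sP dimP.
move=> [C [Cn CA]] [D [Dn DB]] [F [Fn FAB]].
exists (C ++ D ++ chain_opp F); split=> [|x].
  by apply: is_chain_cat => //; apply: is_chain_cat => //; exact: is_chain_opp.
rewrite !chain_ind_cat chain_ind_opp CA DB FAB.
by rewrite addrA indUI addrK.
Qed.

End ChainValues.

Theorem corollary3 (R : realType) (n N : nat) (hn : (1 <= n)%N) (hnN : (n <= N)%N)
    (mu : simplices R N n -> R) (hmu : valuation mu) :
  exists! nu : polytopes R N n -> R,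
    valuation nu /\ forall T : simplices R N n, nu (polytope_of_simplex T) = mu T.
Proof.
have [mu0 muU] := valuation_extend0 hmu.
pose m (X : set 'rV[R]_N) := extend0 mu (convex_hull X).
have m_elem : elementary n.+1 m.
  split=> [|k s i j t z kn sI ij t01 hz]; first by rewrite /m convex_hull0.
  have [iI jI] := aind_edge sI ij t01 hz.
  have dI : affinely_independent (upd s i z \o lift j).
    by apply: aind_comp iI; exact: lift_inj.
  rewrite /m !fhullE (fhull_edgeU ij t01 hz) -(fhull_edgeI sI ij t01 hz) -muU //.
  - exact: fhull_simplices.
  - exact: fhull_simplices.
  - by rewrite -(fhull_edgeU ij t01 hz); exact: fhull_simplices.
  - by rewrite (fhull_edgeI sI ij t01 hz); apply: fhull_simplices => //; exact: ltnW.
(* A combination of simplices is chosen for each polytope; by [chain_val_unique] the value of [nu]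
   does not depend on the choice. *)
have /choice[C CP] (P : polytopes R N n) :
    exists C, is_chain n.+1 C /\ chain_ind C =1 ind (val P).
  by apply: polytope_chain; exact: set_mem (valP P).
pose nu P := chain_val m (C P).
have nu_val : valuation nu.
  split=> [h0|S T hU hI].
    have -> : 0 = chain_val m [::] by rewrite /chain_val big_nil.
    apply: (chain_val_unique m_elem (CP _).1) => // x; rewrite (CP _).2 /=.
    by rewrite /chain_ind big_nil /ind asboolF.
  rewrite /nu -!chain_val_cat; apply: (chain_val_unique m_elem) => [||x].
  - exact: is_chain_cat (CP _).1 (CP _).1.
  - exact: is_chain_cat (CP _).1 (CP _).1.
  by rewrite !chain_ind_cat !(CP _).2 indUI.
have nu_mu T : nu (polytope_of_simplex T) = mu T.
  have [[k [s [sI Ts]]] dimT] := set_mem (valP T).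
  have sT : fhull s `<=` val T by rewrite Ts fhullE.
  have -> : mu T = chain_val m [:: (1, range s)].
    by rewrite /chain_val big_seq1 mulr1z /m -Ts extend0E.
  apply: (chain_val_unique m_elem (CP _).1) => [|x].
    exact: (is_chain1 (aind_card sI sT dimT) sI).
  by rewrite (CP _).2 chain_ind1 -fhullE -Ts.
exists nu; split=> // nu' [nu'_val nu'_mu]; apply/funext => P.
have [_ nuU] := valuation_extend0 nu_val.
have [_ nu'U] := valuation_extend0 nu'_val.
have [polP dimP] := set_mem (valP P).
rewrite -(extend0E nu) -(extend0E nu').
(* Agreement of the two valuations holds on simplices and passes to unions by additivity. *)
apply: (polytope_induction (Q := fun A => extend0 nu A = extend0 nu' A))
  polP => [k s sI sP|A B pA pB pU pI UP EA EB EI].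
  have Ts : fhull s \in simplices R N n.
    by apply/mem_set/fhull_simplices => //; exact: aind_card sI sP dimP.
  pose T : simplices R N n := SigSub Ts.
  by rewrite [fhull s](_ : _ = val (polytope_of_simplex T)) // !extend0E nu_mu nu'_mu.
have mem D : polytope D -> D `<=` A `|` B -> polytopes R N n D.
  by move=> pD DU; split=> //; apply: dim_le_polytope dimP => //; exact: subset_trans UP.
have mA := mem A pA (@subsetUl _ A B); have mB := mem B pB (@subsetUr _ A B).
have mU := mem _ pU (@subset_refl _ _).
have mI : polytopes R N n (A `&` B) by apply: mem => // x [Ax _]; left.
apply: (addIr (extend0 nu (A `&` B))); rewrite -nuU // EI -nu'U // EA EB //.
Qed.
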